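(* Let $k\ge 2$ and $0\le l\le k\le n$ be integers. If $T$ is a tree with $n$ vertices and $p\ge 2$ leaves, then $\bar{\varepsilon}_{k,l}(T)\ge \bar{\varepsilon}_{k,l}(BS(n,p))$.
   Context: For a tree $G$ and $S\subseteq V(G)$, $d_G(S)$ is the number of edges of the minimal subtree of $G$ containing $S$. For an $l$-subset $S$ of $V(G)$ ($n=|V(G)|$), $\varepsilon_{k,l}(S;G)=\max\{d_G(S'): S\subseteq S'\subseteq V(G),\ |S'|=k\}$, and $\bar{\varepsilon}_{k,l}(G)=\binom{n}{l}^{-1}\sum_{|S|=l}\varepsilon_{k,l}(S;G)$. A starlike tree $S(n_1,\dots,n_p)$ ($n_1\ge\dots\ge n_p\ge 1$) consists of a vertex $v$ together with $p$ vertex-disjoint paths with $n_1,\dots,n_p$ vertices, one endpoint of each being joined to $v$; it has $1+\sum n_i$ vertices and $p$ leaves. The balanced starlike tree $BS(n,p)$ is the starlike tree with $n$ vertices and $p$ pendant paths whose numbers of vertices pairwise differ by at most one. *)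

(* Defs.v *)
From HB Require Import structures.
From mathcomp Require Import all_boot all_order all_algebra zify.
Set Implicit Arguments.
Unset Strict Implicit.
Unset Printing Implicit Defensive.
Import Order.TTheory GRing.Theory Num.Theory.

(* A finite simple graph is an adjacency relation [e : rel V] on a [finType];
   symmetry and irreflexivity are part of [is_tree].  The vertex set is an
   explicit [W : {set V}] so that the same predicate applies both to a whole
   graph and to its subgraphs. *)

Section Graphs.
Variable V : finType.
Implicit Types (e : rel V) (W S : {set V}) (F : {set {set V}}).

(* Closed walks of length two are not cycles, hence the bound 2.  Only lengths
   up to #|V| matter, because the vertices of a cycle are distinct; see
   [acyclicP]. *)
Definition acyclic e : bool :=
  [forall n : 'I_(#|V|.+1), forall c : n.-tuple V,
     ucycleb e c ==> (size c <= 2)].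

Lemma acyclicP e :
  reflect (forall c : seq V, ucycle e c -> size c <= 2) (acyclic e).
Proof.
apply: (iffP idP) => [/forallP ac c uc | ac].
  have szc : size c < #|V|.+1.
    by rewrite ltnS; have /andP[_ /card_uniqP <-] := uc; apply: max_card.
  by have /forallP/(_ (in_tuple c))/implyP/(_ uc) := ac (Ordinal szc).
by apply/forallP=> n; apply/forallP=> c; apply/implyP=> /ac.
Qed.

Definition is_tree W e : bool :=
  [&& W != set0,
      [forall x, forall y, e x y ==> (x \in W) && (y \in W)],
      [forall x, ~~ e x x],
      [forall x, forall y, e x y == e y x],
      [forall x in W, forall y in W, connect e x y]
    & acyclic e].

Definition edges e : {set {set V}} :=
  [set E : {set V} | [exists x, exists y, e x y && (E == [set x; y])]].

Definition adj_of F : rel V := [rel x y | (x != y) && ([set x; y] \in F)].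

(* [H] is a subgraph given by its vertex set [H.1] and its edge set [H.2]. *)
Definition subtree e (H : {set V} * {set {set V}}) : bool :=
  (H.2 \subset edges e) && is_tree H.1 (adj_of H.2).

Lemma adj_of_edges e :
  irreflexive e -> symmetric e -> adj_of (edges e) =2 e.
Proof.
move=> irr sym x y; rewrite /adj_of /= inE; apply/andP/idP => [[xy]|exy].
  case/existsP=> a /existsP[b /andP[eab /eqP E]].
  have: x \in [set a; b] by rewrite -E !inE eqxx.
  have: y \in [set a; b] by rewrite -E !inE eqxx orbT.
  rewrite !inE => /orP[]/eqP yE /orP[]/eqP xE; rewrite yE xE ?eqxx // in xy *.
  by rewrite sym.
split; first by apply: contraTneq exy => ->; rewrite irr.
by apply/existsP; exists x; apply/existsP; exists y; rewrite exy eqxx.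
Qed.

Lemma subtree_full e : is_tree [set: V] e -> subtree e ([set: V], edges e).
Proof.
move=> T; rewrite /subtree subxx /=.
have := T => /and5P[_ _ /forallP irr /forallP sym _].
have E : adj_of (edges e) =2 e.
  apply: adj_of_edges => [x|x y]; first exact/negbTE.
  by have /forallP/(_ y)/eqP := sym x.
case/and5P: T => W0 _ _ _ /andP[co /acyclicP ac].
apply/and5P; split=> //.
- by apply/forallP=> x; apply/forallP=> y; rewrite !inE implybT.
- by apply/forallP=> x; rewrite E.
- by apply/forallP=> x; apply/forallP=> y; rewrite !E; have /forallP/(_ y) := sym x.
apply/andP; split.
  apply/forallP=> x; apply/implyP=> Wx; apply/forallP=> y; apply/implyP=> Wy.
  rewrite (eq_connect E).
  by have /forallP/(_ x)/implyP/(_ Wx)/forallP/(_ y)/implyP/(_ Wy) := co.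
by apply/acyclicP=> c; rewrite /ucycle (eq_cycle E) => /ac.
Qed.

(* The default ([set: V], edges e) is the whole graph, which is a subtree
   containing S whenever the graph is a tree. *)
Definition steiner_dist e S : nat :=
  #|[arg min_(H < ([set: V], edges e) | subtree e H && (S \subset H.1))
       #|H.2| ].2|.

Definition leaves e : {set V} := [set x | #|[set y | e x y]| == 1].

Definition eccentricity e (k : nat) S : nat :=
  \max_(S' : {set V} | (S \subset S') && (#|S'| == k)) steiner_dist e S'.

Definition avg_eccentricity e (k l : nat) : rat :=
  ((\sum_(S : {set V} | #|S| == l) eccentricity e k S)%:R
     / ('C(#|V|, l))%:R)%R.

End Graphs.

(* [None] is the centre; the j-th vertex (from 0) of the i-th path is the
   dependent pair (i, j). *)
Definition starlike_vertex (p : nat) (len : 'I_p -> nat) : finType :=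
  option {i : 'I_p & 'I_(len i)}.

Definition starlike (p : nat) (len : 'I_p -> nat) :
    rel (starlike_vertex len) :=
  fun x y => match x, y with
  | None, None => false
  | None, Some u | Some u, None => tagged u == 0 :> nat
  | Some u, Some v => (tag u == tag v)
      && (((tagged u).+1 == tagged v) || ((tagged v).+1 == tagged u))
  end.

(* The nonincreasing sequence of p naturals with sum n - 1 and pairwise
   differences at most one. *)
Definition BS_len (n p : nat) (i : 'I_p) : nat :=
  n.-1 %/ p + (i < n.-1 %% p).

(* For n = p = 2 the lengths are 1 and 0, and this is the one-edge tree. *)
Definition BS (n p : nat) : rel (starlike_vertex (@BS_len n p)) :=
  starlike (len := @BS_len n p).

Lemma BS_len_pos n p (i : 'I_p) : p < n -> 0 < BS_len n i.
Proof.
case: p i => [[]//|p] i; case: n => // n pn.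
by rewrite /BS_len addn_gt0 divn_gt0 // -ltnS pn.
Qed.

Lemma BS_len_noninc n p (i j : 'I_p) : i <= j -> BS_len n j <= BS_len n i.
Proof.
move=> ij; rewrite leq_add2l; case: (ltnP j) => // jr.
by rewrite (leq_ltn_trans ij jr).
Qed.

Lemma BS_len_balanced n p (i j : 'I_p) : BS_len n i <= (BS_len n j).+1.
Proof. by rewrite /BS_len -addnS leq_add2l; do 2![case: (_ < _)]. Qed.

Lemma card_starlike p (len : 'I_p -> nat) :
  #|starlike_vertex len| = (\sum_(i < p) len i).+1.
Proof.
rewrite card_option card_tagged sumnE big_map big_enum /=.
by congr _.+1; apply: eq_bigr => i _; rewrite card_ord.
Qed.

Lemma card_BS n p : 0 < n -> 0 < p -> #|starlike_vertex (@BS_len n p)| = n.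
Proof.
move=> n0 p0; rewrite card_starlike big_split /= sum_nat_const card_ord.
have -> : \sum_(i < p) (i < n.-1 %% p) = n.-1 %% p.
  rewrite -(big_mkord xpredT (fun i => nat_of_bool (i < n.-1 %% p))).
  have rp : n.-1 %% p <= p by rewrite ltnW ?ltn_mod.
  rewrite (big_cat_nat (leq0n _) rp) /= [X in _ + X]big_nat_cond.
  rewrite [X in _ + X]big1 ?addn0.
    transitivity (\sum_(0 <= i < n.-1 %% p) 1).
      by apply: eq_big_nat => i /andP[_ ->].
    by rewrite sum_nat_const_nat subn0 muln1.
  by move=> i /andP[/andP[ri _] _]; rewrite ltnNge ri.
by rewrite mulnC -divn_eq prednK.
Qed.

Lemma BS_len_unique n p (len : 'I_p -> nat) : 0 < p ->
    (forall i j : 'I_p, i <= j -> len j <= len i) ->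
    (forall i j : 'I_p, len i <= (len j).+1) ->
    \sum_(i < p) len i = n.-1 ->
  len =1 @BS_len n p.
Proof.
have lt_contra (f g : 'I_p -> nat) (i : 'I_p) :
    (forall i j : 'I_p, i <= j -> f j <= f i) ->
    (forall i j : 'I_p, i <= j -> g j <= g i) ->
    (forall i j : 'I_p, f i <= (f j).+1) ->
    (forall i j : 'I_p, g i <= (g j).+1) ->
    f i < g i -> \sum_(j < p) f j < \sum_(j < p) g j.
  move=> fd gd fb gb fg; rewrite (bigD1 i) //= [ltnRHS](bigD1 i) //= -addSn.
  apply: leq_add => //; apply: leq_sum => j _.
  have [ij|/ltnW ji] := leqP i j.
    by have := fd _ _ ij; have := gb i j; lia.
  by have := gd _ _ ji; have := fb j i; lia.
move=> p0 dec bal sum i.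
have sumB : \sum_(j < p) BS_len n j = n.-1.
  have := card_BS (ltn0Sn n.-1) p0; rewrite card_starlike => - [].
  by [].
have [lt|lt|//] := ltngtP (len i) (BS_len n i).
  have := lt_contra _ _ i dec (@BS_len_noninc n p) bal (@BS_len_balanced n p) lt.
  by rewrite sum sumB ltnn.
have := lt_contra _ _ i (@BS_len_noninc n p) dec (@BS_len_balanced n p) bal lt.
by rewrite sum sumB ltnn.
Qed.

(* Main.v *)
Require Import Defs.
From mathcomp Require Import all_boot all_order all_algebra all_fingroup zify.
Set Implicit Arguments.
Unset Strict Implicit.
Unset Printing Implicit Defensive.

(** Root the tree at a vertex c and let every other vertex choose a leaf below
    it.  The vertices choosing the same leaf form a chain, so the vertices other
    than c fall into p legs of total length n - 1; write m = k - l.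

    If m > 0, take c to be the centre of the tree.  An optimal k-set can then be
    assumed to span c, so that its Steiner tree consists of c and the non-root
    ancestors of the set.  A vertex of a leg with a chosen vertex at least as
    close to the leaf on the same leg is such an ancestor.  Hence eps(S) is at
    least n - 1 minus the number of cells which the best choice of m further
    vertices leaves uncovered in the starlike tree with the same legs; for
    BS(n,p) this is also an upper bound.  The sum over S of the uncovered counts
    does not decrease when a cell is moved from a longer leg to a shorter one,
    and such moves lead to BS(n,p).

    If m = 0, take c to be a centroid.  Each edge contributes a number depending
    only on the size a <= n/2 of the part below it, and nondecreasing in a.  The
    t-th vertex of a leg, counted from the leaf, has at least t vertices below
    it, and exactly t in BS(n,p); the same moves apply. *)

(** * Cells of starlike trees *)

Section Balance.
Variables (p N : nat).
Implicit Types (len : {ffun 'I_p -> nat}).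

Definition shift_unit len i j : {ffun 'I_p -> nat} :=
  [ffun k => if k == i then (len i).-1 else
             if k == j then (len j).+1 else len k].

(** The terms of the legs i and j stand on both sides, so that no truncated subtraction occurs. *)
Lemma sum_shift_unit len i j (F : 'I_p -> nat -> nat) : i != j ->
  \sum_k F k (shift_unit len i j k) + F i (len i) + F j (len j) =
  \sum_k F k (len k) + F i (len i).-1 + F j (len j).+1.
Proof.
move=> ij; have ji : j != i by rewrite eq_sym.
rewrite (bigD1 i) // (bigD1 j) //= [in RHS](bigD1 i) // [in RHS](bigD1 j) //=.
rewrite !ffunE !eqxx (negPf ji).
rewrite (eq_bigr (fun k => F k (len k))); first by lia.
by move=> k /andP[ki kj]; rewrite ffunE (negPf ki) (negPf kj).
Qed.

(** Induction on the l1-distance to the balanced lengths [B]. If [len] differs from [B], equal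
    totals give a leg i that is too long and a leg j that is too short. Then
    [len j < B j <= (B i).+1 <= len i], and moving one cell from i to j lowers the distance by
    two. *)
Lemma balance_ind (P : {ffun 'I_p -> nat} -> Prop) : 0 < p ->
  (forall len i j, \sum_k len k = N -> len j < len i -> P len ->
     P (shift_unit len i j)) ->
  forall len, \sum_k len k = N -> P len -> P [ffun i => BS_len N.+1 i].
Proof.
move=> p0 Pshift.
set B := [ffun i => _].
have sumB : \sum_k B k = N.
  have := card_BS (ltn0Sn N) p0; rewrite card_starlike => - [] <-.
  by apply: eq_bigr => i _; rewrite ffunE.
move=> len; have [d] := ubnP (\sum_k ((len k - B k) + (B k - len k))).
elim: d len => // d IHd len led sumL PL.
have [/forallP LB|] := boolP [forall k, len k <= B k].
  suff -> : B = len by [].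
  apply/ffunP=> k; apply/eqP; rewrite eqn_leq LB andbT.
  rewrite leqNgt; apply/negP=> lt.
  have : \sum_k len k < \sum_k B k.
    rewrite (bigD1 k) //= [ltnRHS](bigD1 k) //= -addSn leq_add //.
    by apply: leq_sum => j _; apply: LB.
  by rewrite sumL sumB ltnn.
rewrite negb_forall => /existsP[i]; rewrite -ltnNge => Bi.
have [/forallP BL|] := boolP [forall k, B k <= len k].
  have : \sum_k B k < \sum_k len k.
    rewrite (bigD1 i) //= [ltnRHS](bigD1 i) //= -addSn leq_add //.
    by apply: leq_sum => j _; apply: BL.
  by rewrite sumL sumB ltnn.
rewrite negb_forall => /existsP[j]; rewrite -ltnNge => Bj.
have ij : i != j by apply: contraTneq Bi => ->; rewrite -leqNgt ltnW.
have lt : len j < len i.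
  apply: leq_trans Bj (leq_trans _ Bi).
  by rewrite !ffunE; apply: BS_len_balanced.
have := sum_shift_unit len (fun _ x => x) ij => /= sumS.
apply: (IHd (shift_unit len i j)); last by apply: Pshift.
- have arith D D' x y u v : D < d.+1 -> u < x -> y < v ->
      D' + (x - u + (u - x)) + (y - v + (v - y)) =
      D + (x.-1 - u + (u - x.-1)) + (y.+1 - v + (v - y.+1)) -> D' < d by lia.
  exact: arith led Bi Bj (sum_shift_unit len (fun k x => (x - B k) + (B k - x)) ij).
- have arith D D' x y : D = N -> y < x -> D' + x + y = D + x.-1 + y.+1 -> D' = N by lia.
  exact: arith sumL lt sumS.
Qed.

End Balance.

Lemma exists_set_between (X : finType) (A B : {set X}) k :
  A \subset B -> #|A| <= k <= #|B| ->
  exists C : {set X}, [/\ A \subset C, C \subset B & #|C| = k].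
Proof.
move=> AB /andP[]; elim: k => [|k IHk] Ak kB.
  by exists A; split=> //; apply/eqP; rewrite -leqn0.
move: Ak; rewrite leq_eqVlt => /orP[/eqP <-|Ak]; first by exists A.
have [C [AC CB Ck]] := IHk Ak (ltnW kB).
have [x xB xC] : exists2 x, x \in B & x \notin C.
  by apply/subsetPn; apply: contraL kB => /subset_leq_card; rewrite Ck -leqNgt.
exists (x |: C); split; rewrite ?cardsU1 ?xC ?Ck //.
- by apply: subset_trans AC _; apply: subsetUr.
- by rewrite subUset sub1set xB.
Qed.

Lemma exists_top_set (I : finType) (f : I -> nat) m : m <= #|I| ->
  exists A : {set I}, #|A| = m /\ forall i j, i \in A -> j \notin A -> f j <= f i.
Proof.
elim: m => [|m IHm] mI; first by exists set0; split=> [|i]; rewrite ?cards0 ?inE.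
have [A [Am top]] := IHm (ltnW mI).
have [x0 xA] : exists x, x \notin A.
  have [x _ xA] : exists2 x, x \in [set: I] & x \notin A.
    by apply/subsetPn; apply: contraL mI => /subset_leq_card; rewrite Am cardsT -leqNgt.
  by exists x.
case: (@arg_maxnP _ x0 [pred x | x \notin A] f xA) => x /= xnA xmax.
exists (x |: A); split=> [|i j]; first by rewrite cardsU1 xnA Am.
by rewrite !inE negb_or => /orP[/eqP ->|iA] /andP[_ jA]; [apply: xmax|apply: top].
Qed.

Lemma sum_preimset (X : finType) (f : X -> X) (C C' : {set X}) l
    (F : {set X} -> nat) : involutive f -> (forall x, (f x \in C') = (x \in C)) ->
  \sum_(S : {set X} | (S \subset C') && (#|S| == l)) F S =
  \sum_(S : {set X} | (S \subset C) && (#|S| == l)) F (f @^-1: S).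
Proof.
move=> fK fC.
have pK : involutive (fun S : {set X} => f @^-1: S).
  by move=> S; apply/setP=> x; rewrite !inE fK.
rewrite (reindex_inj (inv_inj pK)); apply: eq_bigl => S /=; congr (_ && _).
  apply/subsetP/subsetP => sub x; last by rewrite inE => /sub; rewrite -fC fK.
  by move=> xS; rewrite -fC; apply: sub; rewrite inE fK.
by rewrite -(can_imset_pre _ fK) card_imset //; apply: inv_inj.
Qed.

Section Cells.
Variables (p N : nat).
Notation cell := (option ('I_p * 'I_N.+1)).
Implicit Types (len : {ffun 'I_p -> nat}) (S : {set cell}).

(* The cell [Some (i, s)] is the vertex of leg i at distance s from the leaf of
   that leg; [None] is the centre. *)
Definition cells len : {set cell} :=
  [set x : cell | if x is Some (i, s) then s < len i else true].

(** In a starlike tree a cell is on the path from a vertex of S to the centre exactly when S meets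
    its leg at that level or nearer the leaf. So the vacant cells of a leg form an initial segment
    from the leaf. *)
Definition vacant len S (i : 'I_p) (s : 'I_N.+1) : bool :=
  (s < len i) && [forall t : 'I_N.+1, (t <= s) ==> (Some (i, t) \notin S)].

(* The number of cells left uncovered by S and m further vertices placed
   optimally, one on the leaf of a leg each: at every level s the m best legs are
   discounted. *)
Definition uncovered len m S : nat :=
  \sum_(s < N.+1) (\sum_(i < p) vacant len S i s - m).

Lemma card_ord_lt a : a <= N.+1 -> #|[set s : 'I_N.+1 | s < a]| = a.
Proof.
move=> aN; rewrite -[RHS]card_ord -cardsT.
have inj : injective (widen_ord aN) by move=> x y /(congr1 val)/= /val_inj.
rewrite -(card_imset _ inj).
apply: eq_card => s; rewrite inE; apply/idP/imsetP => [sa|[t _ ->]]; last exact: (ltn_ord t).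
by exists (Ordinal sa) => //; apply: val_inj.
Qed.

Lemma len_le_sum len i : len i <= \sum_k len k.
Proof. by rewrite (bigD1 i) //= leq_addr. Qed.

Lemma sum_cells len (F : 'I_p -> 'I_N.+1 -> nat) :
  \sum_(x : 'I_p * 'I_N.+1 | Some x \in cells len) F x.1 x.2 =
  \sum_i \sum_(s < N.+1 | s < len i) F i s.
Proof. by rewrite pair_big_dep /=; apply: eq_bigl => -[i s]; rewrite inE. Qed.

Lemma card_cells len : \sum_k len k = N -> #|cells len| = N.+1.
Proof.
move=> sumL; rewrite (cardsD1 None) inE /= add1n; congr _.+1.
have -> : cells len :\ None = Some @: [set x | Some x \in cells len].
  apply/setP=> -[[i s]|]; rewrite !inE /=; last by apply/esym/imsetP => -[].
  by rewrite mem_imset ?inE //; apply: Some_inj.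
rewrite card_imset; last exact: Some_inj.
rewrite cardsE -sum1_card (sum_cells len (fun _ _ => 1)) -[RHS]sumL.
apply: eq_bigr => i _; rewrite sum1_card -cardsE card_ord_lt //.
by rewrite -[N]sumL ltnW // ltnS len_le_sum.
Qed.

(** At each level, a leg vacant for S but not for S' contains a cell of S' outside S; different legs
    contain different cells, so at most m legs are lost. *)
Lemma uncovered_sub len m S S' : #|S' :\: S| <= m ->
  uncovered len m S <= uncovered len 0 S'.
Proof.
move=> dm; apply: leq_sum => s _; rewrite subn0 leq_subLR.
apply: leq_trans (leq_add dm (leqnn _)).
have -> : \sum_(i < p) vacant len S i s =
  \sum_(i < p) (vacant len S i s && ~~ vacant len S' i s) +
  \sum_(i < p) (vacant len S i s && vacant len S' i s).
  by rewrite -big_split; apply: eq_bigr => i _; do 2!case: vacant.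
apply: leq_add; last by apply: leq_sum => i _; do 2!case: vacant.
rewrite -big_mkcond /= sum1_card.
(* Legs enter as [Some i], the form in which [omap fst] returns the leg of a cell. *)
rewrite -(card_imset _ (@Some_inj _)).
apply: leq_trans (leq_imset_card (omap fst) _); apply: subset_leq_card.
apply/subsetP=> x /imsetP[i /andP[/andP[sl /forallP f]]].
rewrite negb_and sl /= negb_forall => /existsP[t].
rewrite negb_imply negbK => /andP[ts tS] ->.
have := f t; rewrite ts /= => tnS.
by apply/imsetP; exists (Some (i, t)); rewrite // !inE tnS.
Qed.

Lemma vacant_lower len S i (s t : 'I_N.+1) : t <= s -> vacant len S i s -> vacant len S i t.
Proof.
move=> ts /andP[sl /forallP f]; rewrite /vacant (leq_ltn_trans ts sl) /=.
by apply/forallP=> u; apply/implyP=> ut; have /implyP := f u; apply; apply: leq_trans ts.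
Qed.

Lemma vacantS len S S' i s : S \subset S' -> vacant len S' i s -> vacant len S i s.
Proof.
move=> /subsetP SS /andP[sl /forallP f]; rewrite /vacant sl /=.
apply/forallP=> t; apply/implyP=> ts; have /implyP/(_ ts) := f t.
exact: contra (SS _).
Qed.

(** The new cells go on the leaves of the legs with the longest vacant segments. All these segments
    start at the leaf, so the same legs are the best choice at every level simultaneously. *)
Lemma exists_extension len m S : \sum_k len k = N ->
  S \subset cells len -> #|S| + m <= N.+1 ->
  exists S', [/\ S \subset S', S' \subset cells len, #|S'| = #|S| + m
                & uncovered len 0 S' <= uncovered len m S].
Proof.
move=> sumL SC Sm.
pose b i := #|[set s | vacant len S i s]|.
have b_vacant i j s : b j <= b i -> vacant len S j s -> vacant len S i s.
  move=> bij fj; apply: contraTT bij => fi; rewrite -ltnNge.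
  apply: proper_card; apply/properP; split; last by exists s; rewrite inE.
  apply/subsetP=> t; rewrite !inE => ft; case: (leqP t s) => ts.
    exact: vacant_lower fj.
  by case/negP: fi; apply: vacant_lower ft; apply: ltnW.
have mp : minn m p <= #|'I_p| by rewrite card_ord geq_minr.
have [A [Am top]] := exists_top_set b mp.
(* A leg of length 0 has no leaf cell. If [S :|: M] has fewer than [#|S| + m] cells, it is filled up
   arbitrarily. *)
pose M : {set cell} := [set Some (i, ord0) | i in A & 0 < len i].
have cM : #|M| <= m.
  apply: leq_trans (leq_imset_card _ _) _; apply: leq_trans (geq_minl m p).
  by rewrite -Am; apply: subset_leq_card; apply/subsetP=> i; rewrite !inE => /andP[].
have MC : M \subset cells len.
  by apply/subsetP=> x /imsetP[i]; rewrite !inE => /andP[_ l0] ->.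
have SMC : S :|: M \subset cells len by rewrite subUset SC.
have cSM : #|S :|: M| <= #|S| + m <= #|cells len|.
  rewrite card_cells // Sm andbT; apply: leq_trans (leq_card_setU _ _) _.
  by rewrite leq_add2l.
have [S' [SS' S'C cS']] := exists_set_between SMC cSM.
have sub : S \subset S' by apply: subset_trans SS'; apply: subsetUl.
exists S'; split=> //; apply: leq_sum => s _; rewrite subn0.
have notA i : vacant len S' i s -> i \notin A.
  move=> /andP[sl /forallP/(_ ord0)/=]; apply: contraNN => iA.
  apply: (subsetP SS'); rewrite !inE; apply/orP; right.
  by apply/imsetP; exists i; rewrite // !inE iA (leq_ltn_trans _ sl).
have [[i fi]|none] : (exists i, vacant len S' i s) \/ (forall i, ~~ vacant len S' i s).
- case: (boolP [exists i, vacant len S' i s]) => [/existsP ex|]; first by left.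
  by rewrite negb_exists => /forallP; right.
(* A leg that is still vacant is outside [A], so [A] does not contain all legs and has m elements.
   By its choice, all legs in [A] were vacant for S at level s. *)
- have inA := notA _ fi.
  have Am' : #|A| = m.
    move: Am; case: (leqP m p) => // pm Ap.
    have AT : A == [set: 'I_p] by rewrite eqEcard subsetT cardsT card_ord Ap leqnn.
    by rewrite (eqP AT) inE in inA.
  have fA j : j \in A -> vacant len S j s.
    by move=> jA; apply: (@b_vacant _ i); [apply: top | apply: vacantS fi].
  rewrite -(leq_add2l m) subnKC.
    rewrite -Am' -sum1_card big_mkcond -big_split; apply: leq_sum => j _.
    case: ifP => jA; first by rewrite fA // leq_add2l; case: (boolP (vacant len S' j s)) => // /notA; rewrite jA.
    by case: (boolP (vacant len S' j s)) => // /(vacantS sub) ->.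
  rewrite -Am' -sum1_card big_mkcond; apply: leq_sum => j _.
  by case: ifP => // jA; rewrite fA.
by rewrite big1 // => i _; rewrite (negPf (none i)).
Qed.

(** One level of the exchange: [V] counts the vacant legs other than i and j, while [sa] and [sb]
    mark the levels a and b. Losing the vacancy of leg i lowers the truncated difference only if
    [m <= V]. *)
Lemma exchange_arith (V m : nat) (fi fj fi' fj' sa sb loss gain : bool) :
  (fj -> fj') -> (~~ sa -> fi -> fi') -> (sa || sb -> ~~ fj) ->
  (sa -> fi -> m <= V -> loss) -> (sb -> gain -> fj' && (m <= V)) ->
  (fi + (fj + V) - m) + (sb && gain) <= (fi' + (fj' + V) - m) + (sa && loss).
Proof.
case: sa; case: sb; case: fi; case: fj; case: fi'; case: fj'; case: loss; case: gain;
case: (leqP m V) => /= mV h1 h2 h3 h4 h5;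
by [lia | move: (h1 isT) | move: (h2 isT isT) | move: (h3 isT) | move: (h4 isT isT isT) | move: (h5 isT isT)].
Qed.

(* Transport S along the transposition tau of the moved cell.  The count then
   drops only at the top level of leg i and grows only at the new top level of
   leg j; interchanging the lower parts of the legs i and j (rho) sends the sets
   where it drops to sets where it grows. *)
Lemma uncovered_exchange len i j l m : \sum_k len k = N -> len j < len i ->
  \sum_(S : {set cell} | (S \subset cells len) && (#|S| == l)) uncovered len m S <=
  \sum_(S : {set cell} | (S \subset cells (shift_unit len i j)) && (#|S| == l))
     uncovered (shift_unit len i j) m S.
Proof.
move=> sumL ltji; set len' := shift_unit len i j.
have ji : j != i by apply: contraTneq ltji => ->; rewrite ltnn.
have ij : i != j by rewrite eq_sym.
have lenN k : len k <= N by rewrite -sumL len_le_sum.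
(* Levels count from the leaf, so a is the level of the cell next to the centre that leg i loses,
   and b that of the cell which leg j receives. *)
pose a : 'I_N.+1 := inord (len i).-1; pose b : 'I_N.+1 := inord (len j).
have aE : a = (len i).-1 :> nat by rewrite inordK // (leq_ltn_trans (leq_pred _)) // ltnS.
have bE : b = len j :> nat by rewrite inordK // ltnS.
have len'i : len' i = (len i).-1 by rewrite ffunE eqxx.
have len'j : len' j = (len j).+1 by rewrite ffunE (negPf ji) eqxx.
have len'k k : k != i -> k != j -> len' k = len k.
  by move=> /negPf ki /negPf kj; rewrite ffunE ki kj.
pose tau := tperm (Some (i, a)) (Some (j, b)) : {perm cell}.
have tauK : involutive tau by apply: tpermK.
have tauD k (t : 'I_N.+1) : (k, t) != (i, a) -> (k, t) != (j, b) ->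
    tau (Some (k, t)) = Some (k, t).
  by move=> ki kj; rewrite tpermD //; [rewrite eq_sym in ki|rewrite eq_sym in kj].
have tauC x : (tau x \in cells len') = (x \in cells len).
  rewrite /tau; case: tpermP => [->|->|].
  - by rewrite !inE len'j aE bE ltnSn; lia.
  - by rewrite !inE len'i aE bE ltnn ltnn.
  case: x => [[k t]|]; rewrite !inE //= => /eqP kia /eqP kjb.
  have [ki|ki] := eqVneq k i.
    subst k; rewrite len'i; have : t != a by apply: contra_neq kia => ->.
    by rewrite -val_eqE /= aE; lia.
  have [kj|kj] := eqVneq k j; last by rewrite len'k.
  subst k; rewrite len'j; have : t != b by apply: contra_neq kjb => ->.
  by rewrite -val_eqE /= bE; lia.
rewrite (sum_preimset _ _ tauK tauC).
pose V s S := \sum_(k < p | (k != i) && (k != j)) vacant len S k s.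
(* Under [m <= V] the other legs absorb all m discounts, so a vacant top cell counts for exactly
   one. The condition on (i, a) in [gain] says that the transported set avoids the new cell (j,
   b). *)
pose loss S := vacant len S i a && (m <= V a S).
pose gain S := [&& [forall t : 'I_N.+1, (t < len j) ==> (Some (j, t) \notin S)],
                   Some (i, a) \notin S & m <= V b S].
have pointwise S : uncovered len m S + gain S <= uncovered len' m (tau @^-1: S) + loss S.
  (* Each correction term becomes a sum over levels concentrated at one level, so that the
     inequality can be checked level by level. *)
  have pick c (g : bool) : g = \sum_(s < N.+1) ((s == c) && g) :> nat.
    by rewrite (bigD1 c) //= eqxx big1 ?addn0 // => s /negPf ->.
  rewrite [X in _ + X](pick b) [X in _ <= _ + X](pick a) -!big_split.
  apply: leq_sum => s _ /=.
  rewrite (bigD1 i) // (bigD1 j) //= [in leqRHS](bigD1 i) // [in leqRHS](bigD1 j) //=.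
  rewrite -/(V s S).
  have -> : \sum_(k < p | (k != i) && (k != j)) vacant len' (tau @^-1: S) k s = V s S.
    apply: eq_bigr => k /andP[ki kj]; rewrite /vacant len'k //; congr (_ && _ : nat).
    apply: eq_forallb => t; rewrite inE tauD //.
      by apply: contra_neq ki => -[].
    by apply: contra_neq kj => -[].
  have fj : vacant len S j s -> vacant len' (tau @^-1: S) j s.
    move=> /andP[sj /forallP f]; rewrite /vacant len'j ltnS (ltnW (sj : s < len j)) /=.
    apply/forallP=> t; apply/implyP=> ts; rewrite inE tauD.
    - by have := f t; rewrite ts.
    - by apply: contra_neq ji => -[].
    by apply: contraTneq (leq_ltn_trans ts sj) => -[->]; rewrite bE ltnn.
  have fi : s != a -> vacant len S i s -> vacant len' (tau @^-1: S) i s.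
    move=> sa /andP[sl /forallP f].
    have sa' : s < a by move: sa; rewrite -val_eqE /= aE; lia.
    rewrite /vacant len'i -aE sa' /=.
    apply/forallP=> t; apply/implyP=> ts; rewrite inE tauD.
    - by have := f t; rewrite ts.
    - by apply: contraTneq (leq_ltn_trans ts sa') => -[->]; rewrite ltnn.
    by apply: contra_neq ij => -[].
  have gj : s = b -> gain S -> vacant len' (tau @^-1: S) j s.
    move=> -> /and3P[/forallP f ia _]; rewrite /vacant len'j bE ltnSn /=.
    apply/forallP=> t; apply/implyP=> tj; rewrite inE.
    have [->|tb] := eqVneq t b; first by rewrite tpermR.
    rewrite tauD; first last.
    - by apply: contra_neq tb => -[].
    - by apply: contra_neq ji => -[].
    have := f t; suff -> : t < len j by [].
    by move: tb tj; rewrite -val_eqE /= bE leq_eqVlt => /negPf ->.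
  have nfj : len j <= s -> vacant len S j s = false.
    by rewrite /vacant leqNgt => /negPf ->.
  apply: exchange_arith => //.
  - by case/orP=> /eqP se; rewrite nfj // se ?bE // aE -ltnS (ltn_predK ltji).
  - by move=> /eqP -> fia mV; rewrite /loss fia.
  - by move=> /eqP sb g; rewrite (gj sb g) sb; case/and3P: g.
(* Levels from [len j] on stay fixed, in particular the cell (i, a). *)
pose rho (x : cell) : cell := if x is Some (k, t) then
  if t < len j then Some (if k == i then j else if k == j then i else k, t) else x
  else x.
have rhoK : involutive rho.
  case=> [[k t]|] //=; case tj: (t < len j); rewrite /= tj //.
  have [->|ki] := eqVneq k i; first by rewrite (negPf ji) eqxx.
  by have [->|kj] := eqVneq k j; rewrite ?eqxx // (negPf ki) (negPf kj).
have rhoC x : (rho x \in cells len) = (x \in cells len).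
  case: x => [[k t]|] //=; case: ifP => // tj; rewrite !inE.
  have [->|ki] := eqVneq k i; first by rewrite tj (ltn_trans tj ltji).
  by have [->|kj] := eqVneq k j; first by rewrite tj (ltn_trans tj ltji).
(* For a loss set, leg i is empty up to level a, so after the interchange leg j is empty below
   [len j]. The other legs are unchanged, and [b <= a] makes at least as many of them vacant at b as
   at a. *)
have sum_loss_gain :
    \sum_(S : {set cell} | (S \subset cells len) && (#|S| == l)) (loss S : nat) <=
    \sum_(S : {set cell} | (S \subset cells len) && (#|S| == l)) (gain S : nat).
  rewrite [leqRHS](sum_preimset _ _ rhoK rhoC); apply: leq_sum => S _.
  case: (boolP (loss S)) => // /andP[fia mV]; rewrite lt0b.
  have /andP[_ /forallP f] := fia.
  apply/and3P; split.
  - apply/forallP=> t; apply/implyP=> tj; rewrite inE /= tj (negPf ji) eqxx.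
    by have := f t; have -> : t <= a by rewrite aE; lia.
  - have na : a < len j = false by rewrite aE; lia.
    by rewrite inE /= na; have := f a; rewrite leqnn.
  apply: leq_trans mV _; apply: leq_sum => k /andP[ki kj].
  case: (boolP (vacant len S k a)) => // fka; rewrite lt0b.
  have /andP[bk /forallP g] : vacant len S k b by apply: vacant_lower fka; rewrite aE bE; lia.
  rewrite /vacant bk; apply/forallP=> t; have := g t.
  by rewrite inE /= (negPf ki) (negPf kj) if_same.
rewrite -(leq_add2r (\sum_(S : {set cell} | (S \subset cells len) && (#|S| == l)) (gain S : nat))).
rewrite -big_split /=; apply: leq_trans (leq_sum _ (fun S _ => pointwise S)) _.
by rewrite big_split /= leq_add2l.
Qed.

(** The move replaces the weight of level [(len i).-1] by that of level [len j], which is no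
    higher. *)
Lemma sum_cells_exchange len i j (g : nat -> nat) : {homo g : x y / x <= y} ->
  len j < len i ->
  \sum_k \sum_(0 <= s < shift_unit len i j k) g s <= \sum_k \sum_(0 <= s < len k) g s.
Proof.
move=> gh ltji.
have ij : i != j by apply: contraTneq ltji => ->; rewrite ltnn.
have := sum_shift_unit len (fun _ x => \sum_(0 <= s < x) g s) ij => /=.
rewrite -{1}(ltn_predK ltji) !big_nat_recr //=.
have := gh (len j) (len i).-1; lia.
Qed.

End Cells.

(** * Rooted trees *)

(** The root is a fixed point of [par]; ancestors are then the iterates of [par], and [below] can
    use [fconnect]. *)
Definition rooted (V : finType) (e : rel V) c (par : V -> V) (dep : V -> nat) :=
  [/\ dep c = 0, par c = c, forall x, x != c -> dep x = (dep (par x)).+1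
    & forall x y, e x y = (x != c) && (y == par x) || (y != c) && (x == par y)].

Definition below (V : finType) (par : V -> V) x : {set V} :=
  [set y | fconnect par y x].

(* x stands for the edge {x, par x}, which lies in the Steiner tree of S exactly
   when it separates S. *)
Definition hull (V : finType) (par : V -> V) (S : {set V}) : {set V} :=
  [set x | (S :&: below par x != set0) && ~~ (S \subset below par x)].

Section Rooted.
Variables (V : finType) (e : rel V) (c : V) (par : V -> V) (dep : V -> nat).
Hypothesis R : rooted e c par dep.
Notation D := (below par).

Lemma rooted_ind (P : V -> Prop) :
  P c -> (forall x, x != c -> P (par x) -> P x) -> forall x, P x.
Proof.
move=> Pc Ppar x; have [n] := ubnP (dep x); elim: n x => // n IHn x xn.
have [->//|xc] := eqVneq x c; apply: Ppar => //; apply: IHn.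
by case: R => _ _ /(_ x xc) <-.
Qed.

Lemma mem_below_self x : x \in D x.
Proof. by rewrite inE connect0. Qed.

Lemma belowE x y : (y \in D x) = (y == x) || (y != c) && (par y \in D x).
Proof.
rewrite !inE; apply/idP/idP => [|/orP[/eqP->|/andP[_ yx]]]; last 2 first.
- exact: connect0.
- exact: connect_trans (fconnect1 _ _) yx.
have [->|yc] /= := eqVneq y c.
  move=> /iter_findex <-; rewrite orbF; apply/eqP.
  by elim: (findex _ _ _) => //= n <-; case: R.
case/connectP=> -[|z p] /=; first by move=> _ ->; rewrite eqxx.
case/andP=> /eqP <- pth ->; apply/orP; right; apply/connectP.
by exists p.
Qed.

(** The only edge leaving [below par x] joins x to its parent; this is why a vertex can stand for
    both an edge and a cut. *)
Lemma below_par x y : y != x -> y != c -> (par y \in D x) = (y \in D x).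
Proof. by move=> /negPf yx yc; rewrite [RHS]belowE yx yc. Qed.

Lemma below_root y : y \in D c.
Proof.
elim/rooted_ind: y => [|y yc yD]; first exact: mem_below_self.
by rewrite belowE yc yD orbT.
Qed.

Lemma below_trans x y z : x \in D y -> y \in D z -> x \in D z.
Proof. by rewrite !inE; apply: connect_trans. Qed.

Lemma belowS x y : x \in D y -> D x \subset D y.
Proof. by move=> xy; apply/subsetP=> z zx; apply: below_trans xy. Qed.

Lemma below_dep x y : y \in D x -> (dep x <= dep y) && ((dep y <= dep x) ==> (y == x)).
Proof.
elim/rooted_ind: y => [|y yc IHy].
  by rewrite belowE eqxx orbF => /eqP ->; rewrite eqxx implybT leqnn.
rewrite belowE yc /= => /orP[/eqP ->|/IHy/andP[xy _]].
  by rewrite eqxx implybT leqnn.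
case: R => _ _ /(_ y yc) -> _.
by rewrite leqW //= ltnNge xy.
Qed.

Lemma below_anti x y : x \in D y -> y \in D x -> x = y.
Proof.
by move=> /below_dep/andP[_ /implyP h] /below_dep/andP[/h/eqP].
Qed.

Lemma below_chain x x' y : y \in D x -> y \in D x' -> dep x <= dep x' -> x' \in D x.
Proof.
elim/rooted_ind: y => [|y yc IHy].
  rewrite !(belowE _ c) eqxx !orbF => /eqP <- /eqP <- _; exact: mem_below_self.
have [<- yx _ //|yx'] := eqVneq y x'.
rewrite !(belowE _ y) (negPf yx') yc /= => /orP[/eqP <-|yx] y'x' le.
  have := y'x'; move: le; case: R => _ _ /(_ y yc) -> _ lt /below_dep/andP[].
  by rewrite leqNgt lt.
exact: IHy.
Qed.

Lemma rooted_sym : symmetric e.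
Proof. by case: R => _ _ _ eE x y; rewrite !eE orbC. Qed.

Lemma par_neq x : x != c -> par x != x.
Proof.
by case: R => _ _ dS _ xc; apply/eqP => E; have := dS _ xc; rewrite E; lia.
Qed.

Lemma rooted_irr : irreflexive e.
Proof.
case: R => _ _ _ eE x; rewrite eE orbb; apply/negP => /andP[xc].
by rewrite eq_sym (negPf (par_neq xc)).
Qed.

Lemma edge_dep x y : e x y -> dep y <= dep x -> y = par x.
Proof.
case: R => _ _ dS eE; rewrite eE => /orP[/andP[_ /eqP ->]//|/andP[yc /eqP xE]].
by rewrite (dS _ yc) xE ltnn.
Qed.

(** A vertex of greatest depth on a cycle would have both its cycle neighbours equal to its
    parent. *)
Lemma rooted_acyclic : acyclic e.
Proof.
apply/acyclicP => s /andP[cyc uni]; case: s cyc uni => // x0 s0.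
set s := x0 :: s0 => cyc uni; rewrite leqNgt; apply/negP => sz.
have x0s : x0 \in s by rewrite mem_head.
case: (@arg_maxnP _ x0 [pred x | x \in s] dep x0s) => x /= xs xmax.
have [i p sE] := rot_to xs.
move: cyc uni sz; rewrite -(rot_cycle i) -(rot_uniq i) -(size_rot i) sE.
have pmax y : y \in p -> dep y <= dep x.
  by move=> yp; apply: xmax; rewrite -(mem_rot i) sE inE yp orbT.
case: p {sE} pmax => [//|y q] pmax; case/lastP: q pmax => [//|q z] pmax.
rewrite /= rcons_path last_rcons => /and3P[exy _ ezx] uni _.
have yE := edge_dep exy (pmax _ (mem_head _ _)).
have zE : z = par x.
  by apply: edge_dep; rewrite 1?rooted_sym // pmax // inE mem_rcons mem_head orbT.
by move: uni; rewrite yE zE mem_rcons mem_head /= andbF.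
Qed.

Lemma connect_root x : connect e x c.
Proof.
elim/rooted_ind: x => [|x xc IHx]; first exact: connect0.
apply: connect_trans IHx; apply: connect1.
by case: R => _ _ _ ->; rewrite xc eqxx.
Qed.

Lemma rooted_tree : is_tree [set: V] e.
Proof.
apply/and5P; split; last (apply/andP; split; last exact: rooted_acyclic).
- by apply/set0Pn; exists c; rewrite inE.
- by apply/forallP=> x; apply/forallP=> y; rewrite !inE implybT.
- by apply/forallP=> x; rewrite rooted_irr.
- by apply/forallP=> x; apply/forallP=> y; rewrite rooted_sym.
apply/forallP=> x; apply/implyP=> _; apply/forallP=> y; apply/implyP=> _.
apply: connect_trans (connect_root x) _.
by rewrite (sym_connect_sym rooted_sym); apply: connect_root.
Qed.

Lemma hull_neq_root (S : {set V}) x : x \in hull par S -> x != c.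
Proof.
rewrite inE => /andP[_]; apply: contraNneq => ->.
by apply/subsetP=> y _; apply: below_root.
Qed.

Lemma par_edge_inj : {in [pred x | x != c] &, injective (fun x => [set x; par x])}.
Proof.
move=> x y; rewrite !inE => xc yc E.
have : x \in [set y; par y] by rewrite -E !inE eqxx.
rewrite !inE => /orP[/eqP//|/eqP xE].
have : y \in [set x; par x] by rewrite E !inE eqxx.
rewrite !inE => /orP[/eqP//|/eqP yE].
by case: R => _ _ dS _; have := dS _ xc; have := dS _ yc; rewrite -xE -yE; lia.
Qed.

(** Each x in the hull has vertices of S on both sides of its cut, so a connected subgraph
    containing S must use the edge from x to its parent. *)
Lemma hull_le_subtree (S : {set V}) H : subtree e H -> S \subset H.1 -> #|hull par S| <= #|H.2|.
Proof.
case: H => W F /andP[/= Fe T] SW.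
have inj : {in hull par S &, injective (fun x => [set x; par x])}.
  by move=> x y /hull_neq_root xc /hull_neq_root yc; apply: par_edge_inj.
rewrite -(card_in_imset inj); apply: subset_leq_card.
apply/subsetP=> E /imsetP[x xh ->].
move: (xh); rewrite inE => /andP[/set0Pn[a] /setIP[aS ax] /subsetPn[b bS bx]].
(* Without that edge in [F], the set [D x] would be closed under adjacency in the subtree and could
   not separate a from b. *)
apply: contraTT ax => xF; rewrite -(_ : (b \in D x) = (a \in D x)) //.
have /and5P[_ _ _ _ /andP[/forallP/(_ b) co _]] := T.
have {}co : connect (adj_of F) b a.
  by move: co; rewrite (subsetP SW) //= => /forallP/(_ a); rewrite (subsetP SW).
apply: closed_connect co => u v /= uv.
have : e u v.
  rewrite -(adj_of_edges rooted_irr rooted_sym).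
  by case/andP: uv => /= uv uvF; rewrite /adj_of /= uv (subsetP Fe).
case: R => _ _ _ ->; case/andP: uv => _ uvF.
case/orP=> [/andP[uc /eqP vE]|/andP[vc /eqP uE]].
  rewrite vE below_par //; apply: contraNneq xF => <-.
  by rewrite -vE.
rewrite uE below_par //; apply: contraNneq xF => <-.
by rewrite -uE setUC.
Qed.

(** The subtree consists of the lowest common ancestor t of S and the hull, with the edges from hull
    vertices to their parents. *)
Lemma exists_hull_subtree (S : {set V}) : S != set0 ->
  exists2 H, subtree e H && (S \subset H.1) & #|H.2| <= #|hull par S|.
Proof.
case/set0Pn=> s0 s0S.
have Sc : S \subset D c by apply/subsetP=> y _; apply: below_root.
case: (@arg_minnP _ c [pred t | S \subset D t] (fun t => #|D t|) Sc) => t /= St tmin.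
(* Going up from S inside [D t], the hull can be left only at t. *)
have top x s : s \in S -> s \in D x -> x \notin hull par S -> x \in D t -> x = t.
  move=> sS sx; rewrite inE negb_and !negbK => /orP[/eqP Sx0|Sx xt].
    by have : s \in S :&: D x; [rewrite in_setI sS | rewrite Sx0 inE].
   apply: below_anti => //.
  have : D x == D t by rewrite eqEcard belowS //= tmin.
  by move=> /eqP ->; apply: mem_below_self.
have hullP x : x \in hull par S -> [/\ x != t, x \in D t & exists2 s, s \in S & s \in D x].
  rewrite inE => /andP[/set0Pn[s /setIP[sS sx]] Sx]; split; last by exists s.
    by apply: contraNneq Sx => ->.
  have st := subsetP St _ sS.
  case: (leqP (dep t) (dep x)) => [|/ltnW] le; first exact: below_chain sx le.
  have tx := below_chain sx st le.
  by case/negP: Sx; apply: subset_trans (belowS tx).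
pose W := t |: hull par S; pose F := [set [set x; par x] | x in hull par S].
have parW x : x \in hull par S -> par x \in W.
  move=> xh; have [xt xDt [s sS sx]] := hullP x xh.
  case: (boolP (par x \in hull par S)) => [ph|ph]; first exact: setU1r.
  have xc := hull_neq_root xh.
  rewrite (top (par x) s) ?setU11 // ?below_par //.
  by apply: below_trans sx _; rewrite belowE xc mem_below_self orbT.
have adjF u v : adj_of F u v -> e u v /\ (u \in W) && (v \in W).
  case/andP=> /= uv /imsetP[x xh E]; have xc := hull_neq_root xh.
  have xW : x \in W by apply: setU1r.
  have : u \in [set x; par x] by rewrite -E !inE eqxx.
  have : v \in [set x; par x] by rewrite -E !inE eqxx orbT.
  rewrite !in_set2 => /orP[]/eqP vE /orP[]/eqP uE; subst u v; rewrite ?eqxx // in uv.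
    by case: R => _ _ _ ->; rewrite xc eqxx orbT parW.
  by case: R => _ _ _ ->; rewrite xc eqxx parW // xW.
have symF : symmetric (adj_of F) by move=> u v; rewrite /adj_of /= eq_sym setUC.
have con x : x \in W -> connect (adj_of F) x t.
  elim/rooted_ind: x => [|x xc IHx].
    rewrite in_setU1 => /orP[/eqP->|/hull_neq_root]; rewrite ?eqxx //.
  rewrite in_setU1 => /orP[/eqP->|xh]; first exact: connect0.
  apply: connect_trans (IHx (parW _ xh)); apply: connect1.
  by rewrite /adj_of /= eq_sym par_neq //=; apply/imsetP; exists x.
exists (W, F); last exact: leq_imset_card.
apply/andP; split; last first.
  apply/subsetP=> s sS /=.
  case: (boolP (s \in hull par S)) => [|sh]; first exact: setU1r.
  by rewrite (top s s) ?setU11 ?mem_below_self ?(subsetP St).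
apply/andP; split=> /=.
  apply/subsetP=> _ /imsetP[x xh ->]; rewrite inE.
  apply/existsP; exists x; apply/existsP; exists (par x); rewrite eqxx andbT.
  by case: R => _ _ _ ->; rewrite (hull_neq_root xh) eqxx.
apply/and5P; split; last (apply/andP; split).
- by apply/set0Pn; exists t; apply: setU11.
- by apply/forallP=> u; apply/forallP=> v; apply/implyP=> /adjF[].
- by apply/forallP=> u; rewrite /adj_of /= eqxx.
- by apply/forallP=> u; apply/forallP=> v; rewrite symF.
- apply/forallP=> x; apply/implyP=> xW; apply/forallP=> y; apply/implyP=> yW.
  by apply: connect_trans (con x xW) _; rewrite (sym_connect_sym symF) con.
apply/acyclicP=> s /andP[cs us]; move/acyclicP: rooted_acyclic; apply.
by rewrite /ucycle us andbT; apply: sub_cycle cs => u v /adjF[].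
Qed.

Lemma steiner_distE (S : {set V}) : S != set0 -> steiner_dist e S = #|hull par S|.
Proof.
move=> S0; rewrite /steiner_dist.
case: arg_minnP => [|H /andP[sH SH] min]; first by rewrite subtree_full ?rooted_tree //= subsetT.
apply/eqP; rewrite eqn_leq hull_le_subtree // andbT.
by have [H' PH' le] := exists_hull_subtree S0; apply: leq_trans (min _ PH') le.
Qed.

Lemma below_child x : x != c -> exists z, [/\ z != c, par z = c & x \in D z].
Proof.
elim/rooted_ind: x => [|x xc IHx]; rewrite ?eqxx // => _.
have [pc|pc] := eqVneq (par x) c; first by exists x; split=> //; apply: mem_below_self.
have [z [zc zp xz]] := IHx pc; exists z; split=> //.
by rewrite belowE xc xz orbT.
Qed.

(** Moving the root across one edge reverses only that edge: vertices below z come one step closer,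
    all others move one step away. Centre and centroid are both found by such moves. *)
Lemma reroot z : z != c -> par z = c ->
  rooted e z (fun x => if x == c then z else if x == z then z else par x)
    (fun x => if x \in D z then (dep x).-1 else (dep x).+1).
Proof.
move=> zc zp; have [d0 pc dS eE] := R.
have cz : c \in D z = false by rewrite belowE eqxx orbF eq_sym (negPf zc).
have dz : dep z = 1 by rewrite dS // zp d0.
split=> [| |x xz|x y].
- by rewrite mem_below_self dz.
- by rewrite (negPf zc) eqxx.
- have [->|xc] := eqVneq x c; first by rewrite cz mem_below_self dz d0.
  rewrite (negPf xz) below_par // dS //; case: ifP => // xD.
  rewrite prednK // lt0n; apply: contraNneq (xz) => p0.
  have pxz : par x \in D z by rewrite below_par.
  by have /andP[] := below_dep pxz; rewrite dz p0.
- have cz' : (c == z) = false by rewrite eq_sym (negPf zc).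
  rewrite eE; have [->|xc] := eqVneq x c; have [->|yc] := eqVneq y c;
  rewrite ?cz' ?(negPf zc) //=.
  + by have [->|yz] := eqVneq y z; rewrite ?zp ?eqxx //= ?orbF.
  + by have [->|xz] := eqVneq x z; rewrite ?zp ?eqxx //= ?orbF.
  have [->|xz] := eqVneq x z; have [->|yz] := eqVneq y z;
    by rewrite ?zp ?(negPf zc) ?(negPf xc) ?(negPf yc) ?(negPf xz) ?(negPf yz) ?cz' ?eqxx //= ?orbF.
Qed.

End Rooted.

(** * Choice of the root *)

(** Depth is the distance from c, and the parent is a neighbour one step closer. Any other edge
    would close a cycle with the parent paths of its ends. *)
Lemma tree_rooted (V : finType) (e : rel V) c : is_tree [set: V] e ->
  exists par dep, rooted e c par dep.
Proof.
case/and5P=> _ _ /forallP irr' /forallP sym' /andP[/forallP co' /acyclicP ac].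
have irr x : e x x = false by apply/negbTE.
have sym : symmetric e by move=> x y; have /forallP/(_ y)/eqP := sym' x.
have co x y : connect e x y.
  by have := co' x; rewrite inE => /forallP/(_ y); rewrite inE.
pose reach x n := [exists p : n.-tuple V, path e c p && (last c p == x)].
have reachI p : path e c p -> reach (last c p) (size p).
  by move=> ep; apply/existsP; exists (in_tuple p); rewrite /= ep eqxx.
have exR x : exists n, reach x n.
  by have /connectP[p ep ->] := co c x; exists (size p); apply: reachI.
pose dep x := ex_minn (exR x).
have depP x : exists p, [/\ path e c p, last c p = x & size p = dep x].
  rewrite /dep; case: ex_minnP => n /existsP[p /andP[ep /eqP pl]] _.
  by exists p; rewrite size_tuple.
have dep_le p : path e c p -> dep (last c p) <= size p.
  by move=> /reachI; rewrite /dep; case: ex_minnP => n _; apply.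
have dep_edge x y : e x y -> dep y <= (dep x).+1.
  move=> exy; have [p [ep pl <-]] := depP x.
  have := dep_le (rcons p y); rewrite last_rcons size_rcons; apply.
  by rewrite rcons_path ep pl.
have step x : x != c -> exists y, e y x && (dep x == (dep y).+1).
  have [p [ep <- sp]] := depP x; case/lastP: p ep sp => [|p y]; rewrite ?eqxx //.
  rewrite rcons_path last_rcons size_rcons => /andP[ep ey] sp _.
  exists (last c p); rewrite ey eqn_leq dep_edge //= -sp ltnS; exact: dep_le.
pose par x := if x == c then c else odflt c [pick y | e y x && (dep x == (dep y).+1)].
have parP x : x != c -> e (par x) x && (dep x == (dep (par x)).+1).
  move=> xc; rewrite /par (negPf xc); case: pickP => [//|no].
  by have [y] := step x xc; rewrite no.
exists par, dep; split.
- by apply/eqP; rewrite -leqn0; apply: (dep_le [::]).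
- by rewrite /par eqxx.
- by move=> x /parP/andP[_ /eqP].
move=> x y; apply/idP/orP; last first.
  by case=> /andP[/parP/andP[exy _] /eqP ->]; rewrite // sym.
move=> exy; apply/orP; apply: contraT; rewrite negb_or !negb_and !negbK.
case/andP=> nx ny.
(* The graph without the edge between x and y; all parent edges survive, so it is still
   connected. *)
pose e' := [rel u v | e u v && ([set u; v] != [set x; y])].
have sym'' : symmetric e' by move=> u v; rewrite /= sym [in X in _ && X]setUC.
have coc u : connect e' u c.
  have [n] := ubnP (dep u); elim: n u => // n IHn u un.
  have [->|uc] := eqVneq u c; first exact: connect0.
  have /andP[eu /eqP du] := parP _ uc.
  apply: connect_trans (IHn (par u) _); last by rewrite -ltnS -du.
  apply: connect1; rewrite /= sym eu /=; apply/eqP => E.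
  have : u \in [set x; y] by rewrite -E !inE eqxx.
  have : par u \in [set x; y] by rewrite -E !inE eqxx orbT.
  rewrite !inE => /orP[]/eqP pu /orP[]/eqP ux.
  - by rewrite pu ux irr in eu.
  - by move: ny; rewrite -ux (negPf uc) pu eqxx.
  - by move: nx; rewrite -ux (negPf uc) pu eqxx.
  - by rewrite pu ux irr in eu.
have : connect e' x y.
  by apply: connect_trans (coc x) _; rewrite (sym_connect_sym sym'') coc.
(* A simple path in [e'] closes to a cycle with the deleted edge; the length bound would force the
   path to be that edge. *)
case/connectP=> p0 ep0; case/shortenP: ep0 => p ep up _ yE.
have : size (x :: p) <= 2.
  apply: ac; rewrite /ucycle up /= rcons_path -yE [e y x]sym exy !andbT.
  by apply: sub_path ep => u v /andP[].
case: p ep yE {up} => [|y' [|//]] /=; first by move=> _ yx; rewrite yx irr in exy.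
by move=> /andP[/andP[_ /eqP ne] _] yE; case: ne; rewrite yE.
Qed.

Lemma rooted_pos_dep (V : finType) (e : rel V) c par dep x :
  rooted e c par dep -> x != c -> 0 < dep x.
Proof. by case=> _ _ dS _ /dS ->. Qed.

(** Descent on the greatest depth: if the branch at z violates the condition with x, every vertex
    outside it has depth at most [dep x - 2], and rerooting at z lowers the maximum. *)
Lemma exists_center (V : finType) (e : rel V) : is_tree [set: V] e ->
  exists c par dep, rooted e c par dep /\ forall z x, z != c -> par z = c ->
    x \in below par z -> exists2 y, y \notin below par z & dep x <= (dep y).+1.
Proof.
move=> T; have /and5P[/set0Pn[c _] _ _ _ _] := T.
have [par [dep R]] := tree_rooted c T.
have [n] := ubnP (\max_x dep x); elim: n c par dep R => // n IHn c par dep R dn.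
pose good z x := [exists y, (y \notin below par z) && (dep x <= (dep y).+1)].
have [/forallP ok|] := boolP [forall z, (z != c) && (par z == c) ==>
    [forall x in below par z, good z x]].
  exists c, par, dep; split=> // z x zc zp xz.
  have := ok z; rewrite zc zp eqxx /= => /forallP/(_ x); rewrite xz /=.
  by case/existsP=> y /andP[]; exists y.
rewrite negb_forall => /existsP[z]; rewrite negb_imply => /andP[/andP[zc /eqP zp]].
rewrite negb_forall => /existsP[x]; rewrite negb_imply negb_exists.
move=> /andP[xz /forallP bad].
apply: (IHn _ _ _ (reroot R zc zp)).
rewrite -ltnS; apply: leq_trans dn; rewrite ltnS.
have x0 : 0 < dep x.
  have /andP[zx _] := below_dep R xz.
  exact: leq_trans (rooted_pos_dep R zc) zx.
have xmax : dep x <= \max_v dep v by apply: leq_bigmax.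
rewrite -(ltn_predK (leq_trans x0 xmax)) ltnS; apply/bigmax_leqP => v _.
case: (boolP (v \in below par z)) => vz.
  rewrite -!subn1 leq_sub2r //; exact: leq_bigmax.
have := bad v; rewrite vz /= -ltnNge => lt.
by rewrite -ltnS (ltn_predK (leq_trans x0 xmax)); apply: leq_trans lt xmax.
Qed.

(** Descent on the sum of depths: rerooting at a child with more than half of the vertices below it
    brings more vertices closer than it moves away. Checking children suffices, since every other
    non-root vertex lies below one. *)
Lemma exists_centroid (V : finType) (e : rel V) : is_tree [set: V] e ->
  exists c par dep, rooted e c par dep /\
    forall x, x != c -> (#|below par x|).*2 <= #|V|.
Proof.
move=> T; have /and5P[/set0Pn[c _] _ _ _ _] := T.
have [par [dep R]] := tree_rooted c T.
have [n] := ubnP (\sum_x dep x); elim: n c par dep R => // n IHn c par dep R dn.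
have [/forallP ok|] := boolP [forall z, (z != c) && (par z == c) ==>
    ((#|below par z|).*2 <= #|V|)].
  exists c, par, dep; split=> // x xc; have [z [zc zp xz]] := below_child R xc.
  have := ok z; rewrite zc zp eqxx /=; apply: leq_trans.
  by rewrite leq_double subset_leq_card // (belowS xz).
rewrite negb_forall => /existsP[z]; rewrite negb_imply -ltnNge => /andP[/andP[zc /eqP zp] zV].
apply: (IHn _ _ _ (reroot R zc zp)).
rewrite -ltnS; apply: leq_trans dn; rewrite ltnS.
rewrite (bigID (mem (below par z))) /= [ltnRHS](bigID (mem (below par z))) /=.
have E1 : \sum_(i in below par z) (if i \in below par z then (dep i).-1 else (dep i).+1)
   + #|below par z| = \sum_(i in below par z) dep i.
  rewrite -sum1_card -big_split; apply: eq_bigr => i iz /=; rewrite iz addn1 prednK //.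
  have /andP[zi _] := below_dep R iz.
  exact: leq_trans (rooted_pos_dep R zc) zi.
have E2 : \sum_(i | i \notin below par z) (if i \in below par z then (dep i).-1 else (dep i).+1)
   = \sum_(i | i \notin below par z) dep i + #|~: below par z|.
  rewrite -sum1_card (eq_bigl (fun i => i \notin below par z)).
    rewrite [X in _ + X](eq_bigl (fun i => i \notin below par z)); last by move=> i; rewrite inE.
    by rewrite -big_split; apply: eq_bigr => i /negPf -> /=; rewrite addn1.
  by [].
have := cardsC (below par z); move: E1 E2 zV; rewrite -muln2.
by move: #|V| #|~: _| #|below _ _|; lia.
Qed.

(** Read as parent edges, these form the Steiner tree of S together with c. *)
Definition ancestors (V : finType) (c : V) (par : V -> V) (S : {set V}) : {set V} :=
  [set x | (x != c) && (S :&: below par x != set0)].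

Section Swap.
Variables (V : finType) (e : rel V) (c : V) (par : V -> V) (dep : V -> nat).
Hypothesis R : rooted e c par dep.
Notation D := (below par).
Implicit Type S : {set V}.

Lemma mem_ancestors S x : reflect (x != c /\ exists2 s, s \in S & s \in D x) (x \in ancestors c par S).
Proof.
rewrite inE; apply: (iffP andP) => -[xc].
  by case/set0Pn=> s /setIP[]; split=> //; exists s.
by case=> s sS sx; split=> //; apply/set0Pn; exists s; apply/setIP.
Qed.

Lemma ancestorsS S S' : S \subset S' -> ancestors c par S \subset ancestors c par S'.
Proof.
move=> /subsetP SS; apply/subsetP=> x /mem_ancestors[xc [s /SS sS sx]].
by apply/mem_ancestors; split=> //; exists s.
Qed.

Lemma hull_sub_ancestors S : hull par S \subset ancestors c par S.
Proof.
by apply/subsetP=> x xh; rewrite inE (hull_neq_root R xh); move: xh; rewrite inE => /andP[].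
Qed.

Lemma hull_ancestors S : (forall x, x != c -> ~~ (S \subset D x)) -> hull par S = ancestors c par S.
Proof.
move=> SD; apply/setP=> x; rewrite !inE; have [->|/SD ->] := eqVneq x c; last by rewrite andbT.
by apply/negP=> /andP[_ /negP]; apply; apply/subsetP=> y _; apply: below_root R y.
Qed.

Lemma card_ancestors1 x : #|ancestors c par [set x]| = dep x.
Proof.
elim/(rooted_ind R): x => [|x xc IHx].
  case: R => -> _ _ _; apply/eqP; rewrite cards_eq0; apply/eqP/setP => x.
  apply/mem_ancestors; rewrite inE => -[xc [s /set1P -> ]].
  by rewrite (belowE R) eqxx orbF eq_sym (negPf xc).
have -> : ancestors c par [set x] = x |: ancestors c par [set par x].
  apply/setP=> y; rewrite in_setU1; apply/mem_ancestors/orP.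
    case=> yc [s /set1P ->]; rewrite (belowE R) => /orP[/eqP ->|/andP[_ xy]]; first by left.
    by right; apply/mem_ancestors; split=> //; exists (par x); rewrite ?set11.
  case=> [/eqP ->|/mem_ancestors[yc [s /set1P -> xy]]].
    by split=> //; exists x; rewrite ?set11 ?mem_below_self.
  by split=> //; exists x; rewrite ?set11 // (belowE R) xc xy orbT.
rewrite cardsU1 IHx; case: (R) => _ _ dS _; rewrite (dS _ xc).
suff -> : x \notin ancestors c par [set par x] by [].
apply/mem_ancestors => -[_ [s /set1P -> /(below_dep R)/andP[]]].
by rewrite (dS _ xc) ltnn.
Qed.

Lemma below_of_meet z w s : z != c -> par z = c -> w != c -> s \in D z -> s \in D w -> w \in D z.
Proof.
move=> zc zp wc sz sw.
apply: (below_chain R) sz sw _; case: (R) => d0 _ dS _.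
by rewrite dS // zp d0; apply: rooted_pos_dep R wc.
Qed.

(* If S' lies below a child z of c, replace one of its vertices outside S by a
   vertex y outside [D z]: at most [(dep x).-1] ancestors are lost, and [dep y]
   are gained. *)
Lemma ancestors_le_eccentricity k S S' :
  (forall z x, z != c -> par z = c -> x \in D z ->
     exists2 y, y \notin D z & dep x <= (dep y).+1) ->
  1 < k -> S \subset S' -> #|S'| = k -> #|S| < k ->
  #|ancestors c par S'| <= eccentricity e k S.
Proof.
move=> center k1 SS' cS' cS.
have attain S1 : S \subset S1 -> #|S1| = k ->
    (forall x, x != c -> ~~ (S1 \subset D x)) -> #|ancestors c par S1| <= eccentricity e k S.
  move=> SS1 c1 nD; rewrite -(hull_ancestors nD).
  have S10 : S1 != set0 by rewrite -card_gt0 c1 ltnW.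
  rewrite -(steiner_distE R S10) /eccentricity.
  by apply: (@leq_bigmax_cond _ _ (steiner_dist e)); rewrite SS1 c1 eqxx.
have [/forallP nD|] := boolP [forall x, (x != c) ==> ~~ (S' \subset D x)].
  by apply: attain => // x xc; have := nD x; rewrite xc.
rewrite negb_forall => /existsP[z0]; rewrite negb_imply negbK => /andP[z0c S'z0].
have [z [zc zp z0z]] := below_child R z0c.
have {S'z0} S'z : S' \subset D z by apply: subset_trans S'z0 (belowS z0z).
have [x xS' xS] : exists2 x, x \in S' & x \notin S.
  by apply/subsetPn; apply: contraL cS => /subset_leq_card; rewrite -leqNgt cS'.
have [y yz xy] := center z x zc zp (subsetP S'z _ xS').
pose S2 := S' :\ x; pose S1 := y |: S2.
have c2 : #|S2| = k.-1 by rewrite -cS' [in RHS](cardsD1 x) xS'.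
have S2z : S2 \subset D z by apply: subset_trans S'z; apply: subD1set.
(* Since k is at least 2, a vertex s of S' stays in the branch of z; with y outside that branch, the
   new set spans c. *)
have [s sS2] : exists s, s \in S2.
  by apply/set0Pn; rewrite -card_gt0 c2 -ltnS (ltn_predK k1).
have sz := subsetP S2z _ sS2.
have yS2 : y \notin S2 by apply: contra yz => /(subsetP S2z).
apply: (leq_trans _ (attain S1 _ _ _)); first last.
- move=> w wc; apply/negP=> S1w; case/negP: yz.
  have yw : y \in D w by rewrite (subsetP S1w) // setU11.
  have sw : s \in D w by rewrite (subsetP S1w) // setU1r.
  exact: below_trans yw (below_of_meet zc zp wc sz sw).
- by rewrite cardsU1 yS2 c2 add1n (ltn_predK k1).
- apply/subsetP=> v vS; apply: setU1r; rewrite in_setD1 (subsetP SS') // andbT.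
  by apply: contraNneq xS => <-.
have xz := subsetP S'z _ xS'.
have zx : z \in ancestors c par [set x] by apply/mem_ancestors; split=> //; exists x; rewrite ?set11.
(* z remains an ancestor of s, so it is not lost with x. *)
have sub' : ancestors c par S' \subset ancestors c par S2 :|: (ancestors c par [set x] :\ z).
  apply/subsetP=> w /mem_ancestors[wc [v vS' vw]]; rewrite in_setU in_setD1.
  have [->|wz] := eqVneq w z.
    by apply/orP; left; apply/mem_ancestors; split=> //; exists s.
  have [vx|vx] := eqVneq v x.
    by apply/orP; right; apply/mem_ancestors; split=> //; exists x; rewrite ?set11 // -vx.
  by apply/orP; left; apply/mem_ancestors; split=> //; exists v; rewrite // in_setD1 vx.
apply: leq_trans (subset_leq_card sub') _.
apply: leq_trans (leq_card_setU _ _) _.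
have := card_ancestors1 x; rewrite (cardsD1 z) zx add1n => cx.
(* The non-root ancestors of y lie outside the branch of z, so all of them are new. *)
have dis : [disjoint ancestors c par S2 & ancestors c par [set y]].
  rewrite disjoint_subset; apply/subsetP=> w /mem_ancestors[wc [v vS2 vw]].
  apply/negP=> /mem_ancestors[_ [_ /set1P -> yw]]; case/negP: yz.
  exact: below_trans yw (below_of_meet zc zp wc (subsetP S2z _ vS2) vw).
apply: (@leq_trans #|ancestors c par S2 :|: ancestors c par [set y]|).
  rewrite cardsU disjoint_setI0 // cards0 subn0 leq_add2l card_ancestors1.
  by rewrite -ltnS -cx in xy.
apply: subset_leq_card; rewrite subUset; apply/andP; split; apply: ancestorsS.
  exact: subsetUr.
by rewrite sub1set setU11.
Qed.

End Swap.

(** * Legs of a rooted tree *)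

Lemma uncovered0E p N (len : {ffun 'I_p -> nat}) (S : {set option ('I_p * 'I_N.+1)}) :
  uncovered len 0 S = #|[set x : 'I_p * 'I_N.+1 | vacant len S x.1 x.2]|.
Proof.
rewrite /uncovered; under eq_bigr do rewrite subn0.
rewrite exchange_big pair_big /= -sum1_card [RHS]big_mkcond.
by apply: eq_bigr => -[i s] _; rewrite inE; case: vacant.
Qed.

(** Only a bijection of vertices onto cells. How positions relate to ancestry is a separate
    hypothesis of the lemmas, an implication whose direction decides between lower and upper
    bounds. *)
Definition coding p N (V : finType) (c : V) (len : {ffun 'I_p -> nat})
    (code : V -> option ('I_p * 'I_N.+1)) :=
  [/\ \sum_i len i = N, injective code, code @: [set: V] = cells N len & code c = None].

Section Coding.
Variables (p N : nat) (V : finType) (c : V) (len : {ffun 'I_p -> nat}).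
Variables (code : V -> option ('I_p * 'I_N.+1)) (par : V -> V).
Hypothesis K : coding c len code.
Notation D := (below par).
Implicit Type S : {set V}.

Lemma code_cells x : code x \in cells N len.
Proof. by case: K => _ _ <- _; apply: imset_f. Qed.

Lemma codeP i (s : 'I_N.+1) : s < len i -> exists2 x, x != c & code x = Some (i, s).
Proof.
move=> sl; have : Some (i, s) \in cells N len by rewrite inE.
case: K => _ inj <- c0 /imsetP[x _ xE]; exists x => //.
by apply: contra_eq_neq xE => ->; rewrite c0.
Qed.

Lemma code_neq_root x : x != c -> exists i s, code x = Some (i, s).
Proof.
case: K => _ inj _ c0; case E: (code x) => [[i s]|]; first by exists i, s.
by rewrite -(inj x c) ?eqxx // E c0.
Qed.

Lemma card_coding : #|V| = N.+1.
Proof. by case: K => sN inj im _; rewrite -cardsT -(card_imset _ inj) im card_cells. Qed.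

Lemma code_imset_sub S : code @: S \subset cells N len.
Proof. by case: K => _ _ <- _; apply/imsetS/subsetT. Qed.

Lemma code_imset_preim (S : {set option ('I_p * 'I_N.+1)}) :
  S \subset cells N len -> code @: (code @^-1: S) = S.
Proof.
case: K => _ _ <- _ sub; apply/setP=> y; apply/imsetP/idP => [[x]|yS].
  by rewrite inE => xS ->.
by have /imsetP[x _ yE] := subsetP sub _ yS; exists x; rewrite // inE -yE.
Qed.

Lemma sum_code l (F : {set option ('I_p * 'I_N.+1)} -> nat) :
  \sum_(S : {set V} | #|S| == l) F (code @: S) =
  \sum_(S : {set option ('I_p * 'I_N.+1)} | (S \subset cells N len) && (#|S| == l)) F S.
Proof.
rewrite [RHS](reindex_onto (fun S : {set V} => code @: S)
                (fun S : {set option ('I_p * 'I_N.+1)} => code @^-1: S)).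
  apply: eq_bigl => S; case: (K) => _ inj _ _.
  rewrite code_imset_sub card_imset //=.
  suff -> : code @^-1: (code @: S) == S by rewrite andbT.
  by apply/eqP/setP=> x; rewrite inE mem_imset.
by move=> S /andP[sub _]; apply: code_imset_preim.
Qed.

Lemma sum_code_pos (g : nat -> nat) :
  \sum_(x | x != c) (if code x is Some (i, s) then g s else 0) =
  \sum_i \sum_(0 <= s < len i) g s.
Proof.
have lenN i : len i <= N.+1 by case: K => sN _ _ _; rewrite -[X in _ <= X.+1]sN ltnW // ltnS len_le_sum.
transitivity (\sum_i \sum_(s < N.+1 | s < len i) g s); last first.
  by apply: eq_bigr => i _; rewrite big_mkord (big_ord_widen _ _ (lenN i)).
rewrite -(sum_cells len (fun _ s => g s)) /=.
case: (K) => _ inj im c0.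
pose G (y : option ('I_p * 'I_N.+1)) := if y is Some (i, s) then g s else 0.
transitivity (\sum_(y in cells N len) G y).
  rewrite -im big_imset /=; last by move=> ? ? _ _; apply: inj.
  rewrite [RHS](bigD1 c) ?inE //= c0 add0n.
  by apply: eq_bigl => x; rewrite inE.
rewrite (bigD1 None) ?inE //= add0n.
rewrite (reindex_omap Some id) /=; last by case=> [x|]; rewrite ?eqxx ?andbF.
apply: eq_big => [x|[i s] _] //.
by rewrite eqxx !andbT.
Qed.

Lemma card_below_ge x i (s : 'I_N.+1) : code x = Some (i, s) ->
  (forall x y i s t, code x = Some (i, s) -> code y = Some (i, t) -> s <= t -> x \in D y) ->
  s < #|D x|.
Proof.
move=> xE ord; have := code_cells x; rewrite xE inE => sl.
case: (K) => _ inj _ _; rewrite -(card_imset _ inj).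
have : #|[set Some (i, t) | t in [set t : 'I_N.+1 | t < s.+1]]| = s.+1.
  by rewrite card_imset ?card_ord_lt // => ? ? [].
move=> <-; apply: subset_leq_card; apply/subsetP=> y /imsetP[t]; rewrite inE ltnS => ts ->.
have [z _ zE] := codeP (leq_ltn_trans ts sl).
by apply/imsetP; exists z => //; apply: ord zE xE ts.
Qed.

Lemma card_below_le x i (s : 'I_N.+1) : code x = Some (i, s) ->
  (forall x y i t, code y = Some (i, t) -> x \in D y ->
     exists2 s, code x = Some (i, s) & s <= t) ->
  #|D x| <= s.+1.
Proof.
move=> xE ord; case: (K) => _ inj _ _; rewrite -(card_imset _ inj).
rewrite -[leqRHS](@card_ord_lt N) //.
have inj' : injective (fun t : 'I_N.+1 => Some (i, t)) by move=> ? ? [].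
rewrite -(card_imset _ inj'); apply: subset_leq_card.
apply/subsetP=> y /imsetP[z zx ->]; have [t -> ts] := ord _ _ _ _ xE zx.
by apply: imset_f; rewrite inE ltnS.
Qed.

Lemma card_nonroot : #|[set~ c]| = N.
Proof. by have := cardsC1 c; rewrite card_coding. Qed.

(** A non-root vertex that is not an ancestor has a vacant cell, because a vertex of S on its leg at
    the same or a smaller position would lie below it. *)
Lemma ancestors_ge S :
  (forall x y i s t, code x = Some (i, s) -> code y = Some (i, t) -> s <= t -> x \in D y) ->
  N <= #|ancestors c par S| + uncovered len 0 (code @: S).
Proof.
move=> ord; case: (K) => _ inj _ _; rewrite -{1}card_nonroot uncovered0E.
rewrite -(cardsID (ancestors c par S)); apply: leq_add.
  by apply: subset_leq_card; apply: subsetIr.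
rewrite -(card_imset _ inj) -[leqRHS](card_imset _ (@Some_inj _)).
apply: subset_leq_card; apply/subsetP=> y /imsetP[x]; rewrite in_setD in_setC1.
move=> /andP[xS xc] ->; have [i [s xE]] := code_neq_root xc.
rewrite xE; apply: imset_f; rewrite inE /vacant /=.
have := code_cells x; rewrite xE inE => -> /=.
apply/forallP=> t; apply/implyP=> ts; apply: contra xS => /imsetP[z zS zE].
by apply/mem_ancestors; split=> //; exists z => //; apply: ord (esym zE) xE ts.
Qed.

Lemma ancestors_le S :
  (forall x y i t, code y = Some (i, t) -> x \in D y ->
     exists2 s, code x = Some (i, s) & s <= t) ->
  #|ancestors c par S| + uncovered len 0 (code @: S) <= N.
Proof.
move=> ord; case: (K) => _ inj _ _; rewrite -{3}card_nonroot uncovered0E.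
rewrite -(cardsID (ancestors c par S) [set~ c]); apply: leq_add.
  apply: subset_leq_card; apply/subsetP=> x xS; rewrite inE xS andbT in_setC1.
  by case/mem_ancestors: xS.
rewrite -(card_imset _ (@Some_inj _)) -[leqRHS](card_imset _ inj).
apply: subset_leq_card; apply/subsetP=> y /imsetP[[i s]]; rewrite inE /=.
move=> /andP[sl /forallP f] ->; have [x xc xE] := codeP sl.
apply/imsetP; exists x => //; rewrite in_setD in_setC1 xc andbT.
apply/mem_ancestors => -[_ [z zS zx]]; have [t zE ts] := ord _ _ _ _ xE zx.
by have := f t; rewrite ts /= -zE imset_f.
Qed.

End Coding.

(** Vertices choosing the same leaf all have it below them, hence form a chain, numbered from its
    deep end. If c is itself a leaf, its leg is empty. *)
Lemma exists_coding p N (V : finType) (e : rel V) c par dep :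
  rooted e c par dep -> #|V| = N.+1 -> #|leaves e| = p -> 0 < p ->
  exists (len : {ffun 'I_p -> nat}) (code : V -> option ('I_p * 'I_N.+1)),
    coding c len code /\
    forall x y i s t, code x = Some (i, s) -> code y = Some (i, t) -> s <= t ->
      x \in below par y.
Proof.
move=> R cV cL p0; subst p.
have [l0 l0L] : exists l0, l0 \in leaves e by apply/set0Pn; rewrite -card_gt0.
pose lf x := odflt l0 [pick y in leaves e :&: below par x].
have lfP x : x != c -> lf x \in leaves e /\ lf x \in below par x.
  move=> xc; rewrite /lf; case: pickP => [y /setIP[]//|none].
  (* A deepest vertex below x is a leaf. *)
  case: (@arg_maxnP _ x [pred y | y \in below par x] dep (mem_below_self _ _)) => y /= yx ymax.
  have yc : y != c.
    by apply: contraTneq yx => ->; rewrite (belowE R) eqxx orbF eq_sym.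
  have := none y; rewrite in_setI yx andbT inE => /negbT/negP[].
  apply/cards1P; exists (par y); apply/setP=> w; rewrite inE in_set1.
  case: (R) => _ _ dS ->; rewrite yc /=.
  case: eqP => //= _; apply/negP => /andP[wc /eqP yE].
  have : w \in below par x by rewrite (belowE R) wc -yE yx orbT.
  by move=> /ymax; rewrite (dS _ wc) -yE ltnn.
pose leg x := enum_rank_in l0L (lf x).
have legP x y : x != c -> y != c -> leg x = leg y -> lf x = lf y.
  by move=> /lfP[xl _] /lfP[yl _]; apply: enum_rank_in_inj.
pose fiber i := [set x | (x != c) && (leg x == i)].
pose len := [ffun i => #|fiber i|].
have sumL : \sum_i len i = N.
  have <- : #|[set~ c]| = N by rewrite cardsC1 cV.
  rewrite -[RHS]sum1_card (partition_big leg xpredT) //=; apply: eq_bigr => i _.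
  by rewrite ffunE -[LHS]sum1_card; apply: eq_bigl => x; rewrite !inE.
pose pos x := #|[set y in fiber (leg x) | dep x < dep y]|.
have pos_len x : x != c -> pos x < len (leg x).
  move=> xc; rewrite ffunE; apply: proper_card; apply/properP; split.
    by apply/subsetP=> y; rewrite inE => /andP[].
  by exists x; rewrite !inE ?xc ?eqxx //= ltnn.
have posN x : x != c -> pos x < N.+1.
  by move=> xc; rewrite ltnW // ltnS (leq_trans (pos_len x xc)) // -sumL len_le_sum.
have pos_anti x y : x != c -> y != c -> leg x = leg y -> dep x < dep y -> pos y < pos x.
  move=> xc yc E lt; rewrite /pos E; apply: proper_card; apply/properP; split.
    by apply/subsetP=> z; rewrite !inE => /andP[-> /(ltn_trans lt)].
  by exists y; rewrite !inE ?yc ?eqxx ?lt //= ltnn.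
have order x y : x != c -> y != c -> leg x = leg y -> pos x <= pos y -> x \in below par y.
  move=> xc yc E le; have [_ lx] := lfP x xc; have [_ ly] := lfP y yc.
  rewrite -(legP x y) // in ly; apply: (below_chain R) ly lx _.
  by rewrite leqNgt; apply: contraTN le => /(pos_anti x y xc yc E); rewrite -ltnNge.
pose code x : option ('I_#|leaves e| * 'I_N.+1) :=
  if x == c then None else Some (leg x, inord (pos x)).
have codeE x i s : code x = Some (i, s) -> [/\ x != c, leg x = i & pos x = s].
  rewrite /code; case: eqVneq => // xc [-> <-]; rewrite inordK //; exact: posN.
have inj : injective code.
  move=> x y; case E: (code x) => [[i s]|]; last first.
    by move: E; rewrite /code; do 2!case: eqP => // ->.
  move/esym/codeE => [yc ly py]; have [xc lx px] := codeE _ _ _ E.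
  by apply: (below_anti R); apply: order; rewrite ?lx ?ly ?px ?py.
exists len, code; split; last first.
  move=> x y i s t /codeE[xc lx px] /codeE[yc ly py] st.
  by apply: order; rewrite ?lx ?ly ?px ?py.
split=> //; last by rewrite /code eqxx.
apply/eqP; rewrite eqEcard card_cells // card_imset // cardsT cV leqnn andbT.
apply/subsetP=> z /imsetP[x _ ->]; rewrite inE.
case E: (code x) => [[i s]|//]; have [xc <- <-] := codeE _ _ _ E.
exact: pos_len.
Qed.

(** * Separated sets and starlike trees *)

(* The number of k-subsets of an n-set separated by a given a-subset. *)
Definition separated_count n k a := 'C(n, k) - ('C(a, k) + 'C(n - a, k)).

(** For k > 0, Pascal's rule shows that passing from b to b + 1 adds 'C(b, k - 1) to the subtracted
    sum and removes 'C(n - b - 1, k - 1), which is at least as large while b < n/2. *)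
Lemma separated_count_mono n k a b : a <= b -> b.*2 <= n ->
  separated_count n k a <= separated_count n k b.
Proof.
move=> ab bn; apply: leq_sub2l.
elim: b ab bn => [|b IHb]; first by rewrite leqn0 => /eqP ->.
rewrite leq_eqVlt => /orP[/eqP <- //|ab] bn.
apply: leq_trans (IHb ab _); last by apply: leq_trans bn; rewrite leq_double.
case: k {IHb} => [|k]; first by rewrite !bin0.
have -> : n - b = (n - b.+1).+1 by lia.
rewrite !binS -addnA leq_add2l addnC leq_add2l.
by apply: leq_bin2l; lia.
Qed.

(** A k-set that A does not separate lies in A or in its complement, and for positive k not in
    both. *)
Lemma card_separated (V : finType) (A : {set V}) k : 0 < k ->
  #|[set S : {set V} | (#|S| == k) && ((S :&: A != set0) && ~~ (S \subset A))]| =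
  separated_count #|V| k #|A|.
Proof.
move=> k0.
pose B1 := [set S : {set V} | (S \subset A) && (#|S| == k)].
pose B2 := [set S : {set V} | (S \subset ~: A) && (#|S| == k)].
have c1 : #|B1| = 'C(#|A|, k) by apply: cards_draws.
have c2 : #|B2| = 'C(#|V| - #|A|, k) by rewrite cards_draws [#|~: A|]cardsCs setCK.
have B12 : B1 :&: B2 = set0.
  apply/setP=> S; rewrite !inE; apply/negP => /andP[/andP[SA /eqP Sk] /andP[SAC _]].
  move: k0; rewrite -Sk lt0n cards_eq0 -subset0 -(setICr A) subsetI SA; exact/negP/negPn.
rewrite /separated_count -card_draws -c1 -c2 -[_ + _]subn0 -(cards0 {set V}) -B12 -cardsU.
have sub : B1 :|: B2 \subset [set S : {set V} | #|S| == k].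
  by apply/subsetP=> S; rewrite !inE => /orP[]/andP[].
rewrite -(setIidPr sub) -cardsD; apply: eq_card => S; rewrite !inE -disjoints_subset -setI_eq0.
by case: (#|S| == k) => //=; rewrite ?andbF //= !andbT negb_or andbC.
Qed.

Section Starlike.
Variables (p : nat) (len : 'I_p -> nat).
Notation V := (starlike_vertex len).
Notation vertex s := (Some (Tagged (fun i => 'I_(len i)) s)).

Definition starlike_dep (x : V) : nat := if x is Some u then (tagged u).+1 else 0.

Definition starlike_par (x : V) : V :=
  if x is Some (existT i s) then
    if s == 0 :> nat then None else vertex (ord_pred s)
  else None.

Lemma starlike_eqE i s j t :
  (Some (existT (fun i => 'I_(len i)) i s) == Some (existT (fun i => 'I_(len i)) j t)) =
  (i == j) && (s == t :> nat).
Proof.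
rewrite -[LHS]/(Tagged (fun i => 'I_(len i)) s == Tagged (fun i => 'I_(len i)) t).
rewrite -tag_eqE /tag_eq /=; case: (eqVneq i j) t => // <- t.
by rewrite tagged_asE.
Qed.

(** [ord_pred] is cyclic, so it is the ordinary predecessor only away from 0. *)
Lemma ord_predE n (s : 'I_n) : s != 0 :> nat -> (s + n).-1 %% n = s.-1.
Proof.
case: n s => [[]//|n] s s0; have -> : (s + n.+1).-1 = s.-1 + n.+1 by move: s0; lia.
by rewrite modnDr modn_small // (leq_ltn_trans (leq_pred _)).
Qed.

Lemma starlike_rooted : rooted (starlike (len := len)) None starlike_par starlike_dep.
Proof.
split=> // [[[i s]|]|x y] //.
  move=> _ /=; case: eqP => [->//|/eqP s0] /=.
  by rewrite ord_predE // prednK // lt0n.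
case: x => [[i s]|]; case: y => [[j t]|] //=; rewrite ?orbF ?andbF //; last 2 first.
- by case: eqP.
- by case: eqP.
case: (eqVneq (s : nat) 0) => [s0|s0]; case: (eqVneq (t : nat) 0) => [t0|t0] //=;
  rewrite ?starlike_eqE /= ?ord_predE ?[j == i]eq_sym ?orbF //.
- by rewrite s0 t0 andbF.
- by case: (i == j) => //=; lia.
- by case: (i == j) => //=; lia.
- by case: (i == j) => //=; lia.
Qed.

Variable N : nat.
Hypothesis sumL : \sum_i len i = N.

(** The paths of [starlike] are numbered from the centre and cells from the leaf, hence the
    reversal. *)
Definition starlike_code (x : V) : option ('I_p * 'I_N.+1) :=
  if x is Some (existT i s) then Some (i, inord (len i - s.+1)) else None.

Lemma starlike_coding : coding None (finfun len) starlike_code.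
Proof.
have lenN i : len i <= N by rewrite -sumL (bigD1 i) //= leq_addr.
have codeE i (s : 'I_(len i)) : @inord N (len i - s.+1) = len i - s.+1 :> nat.
  by rewrite inordK // ltnS (leq_trans (leq_subr _ _)).
have inj : injective starlike_code.
  move=> [[i s]|] [[j t]|] //= [E1 E2]; apply/eqP; rewrite starlike_eqE.
  subst j; rewrite eqxx /=; have := congr1 val E2; rewrite /= !codeE.
  by have := ltn_ord s; have := ltn_ord t; lia.
have sumF : \sum_i (finfun len) i = N by under eq_bigr do rewrite ffunE.
split=> //; apply/eqP; rewrite eqEcard card_cells // card_imset // cardsT.
rewrite card_starlike sumL leqnn andbT.
apply/subsetP=> y /imsetP[[[i s]|] _ ->]; rewrite inE //= codeE ffunE.
by have := ltn_ord s; lia.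
Qed.

Lemma starlike_order (x y : V) i t : starlike_code y = Some (i, t) ->
  x \in below starlike_par y ->
  exists2 s, starlike_code x = Some (i, s) & s <= t.
Proof.
case: y => [[i' s]|] //= [E1 E2]; subst i'.
have lenN : len i <= N by rewrite -sumL (bigD1 i) //= leq_addr.
suff H : x \in below starlike_par (vertex s) ->
    exists2 r : 'I_(len i), x = vertex r & s <= r.
  move=> /H[r -> sr]; exists (inord (len i - r.+1)) => //.
  rewrite -E2 !inordK ?leq_sub2l // ltnS (leq_trans (leq_subr _ _)) //.
elim/(rooted_ind starlike_rooted): x => [|x xc IHx].
  by rewrite (belowE starlike_rooted) eqxx orbF.
rewrite (belowE starlike_rooted) xc /= => /orP[/eqP ->|/IHx[r]]; first by exists s.
case: x xc {IHx} => [[j q]|//] _ /=; case: eqP => // /eqP q0 /eqP.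
rewrite starlike_eqE /= ord_predE // => /andP[/eqP ji /eqP qr]; subst j => sr.
by exists q => //; by rewrite -qr in sr; apply: leq_trans sr (leq_pred _).
Qed.

End Starlike.

(** * Comparison with BS(n,p) *)

(** A leg has the extra vertex only if the remainder is positive, and the remainder then pays for
    it. The bound makes the clipping below invisible for BS(n,p). *)
Lemma double_BS_len n p (i : 'I_p) : 1 < p -> (BS_len n i).*2 <= n.
Proof.
case: n => [|n] p1; first by rewrite /BS_len div0n mod0n.
rewrite /BS_len /=; have := divn_eq n p; set q := n %/ p; set r := n %% p.
have : q * 2 <= q * p by rewrite leq_mul2l p1 orbT.
move: (q * p) => x xq ->; case: (ltnP i r) => ir /=; last by lia.
have : 0 < r by apply: leq_ltn_trans ir.
lia.
Qed.

(* Clipping at n/2 makes the count nondecreasing, so that the exchange applies to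
   legs of any length. *)
Definition clipped_count n k s := separated_count n k (minn s.+1 n./2).

Section Bounds.
Variables (p N : nat) (V : finType) (e : rel V) (c : V) (par : V -> V) (dep : V -> nat).
Variables (len : {ffun 'I_p -> nat}) (code : V -> option ('I_p * 'I_N.+1)).
Hypotheses (R : rooted e c par dep) (K : coding c len code).
Implicit Type S : {set V}.

(** The extension found among the cells is pulled back along [code] to a k-set; since c is a centre,
    the eccentricity is at least the number of its ancestors. *)
Lemma eccentricity_ge k S :
  (forall z x, z != c -> par z = c -> x \in below par z ->
     exists2 y, y \notin below par z & dep x <= (dep y).+1) ->
  (forall x y i s t, code x = Some (i, s) -> code y = Some (i, t) -> s <= t ->
     x \in below par y) ->
  1 < k -> k <= N.+1 -> #|S| < k ->
  N <= eccentricity e k S + uncovered len (k - #|S|) (code @: S).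
Proof.
move=> center order k1 kN Sk; case: (K) => sumL inj _ _.
have cS : #|code @: S| + (k - #|S|) = k by rewrite card_imset // subnKC // ltnW.
have kN' : #|code @: S| + (k - #|S|) <= N.+1 by rewrite cS.
have [S' [SS' S'C cS' unc]] := exists_extension sumL (code_imset_sub K S) kN'.
pose S1 := code @^-1: S'; have S1E : code @: S1 = S' := code_imset_preim K S'C.
have c1 : #|S1| = k by rewrite -cS -cS' -S1E card_imset.
have SS1 : S \subset S1.
  by apply/subsetP=> x xS; rewrite inE (subsetP SS') // imset_f.
apply: leq_trans (ancestors_ge K S1 order) _; rewrite S1E; apply: leq_add => //.
exact: (ancestors_le_eccentricity R center k1 SS1 c1 Sk).
Qed.

(** A k-set containing S adds [k - #|S|] cells, so [uncovered_sub] bounds its ancestors, among which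
    the hull lies. *)
Lemma eccentricity_le k S :
  (forall x y i t, code y = Some (i, t) -> x \in below par y ->
     exists2 s, code x = Some (i, s) & s <= t) ->
  0 < k -> #|S| <= k ->
  eccentricity e k S + uncovered len (k - #|S|) (code @: S) <= N.
Proof.
move=> order k0 Sk; case: (K) => _ inj _ _.
have uncN : uncovered len (k - #|S|) (code @: S) <= N.
  apply: leq_trans (leq_trans (leq_addl _ _) (ancestors_le K S order)).
  by apply: leq_sum => s _; rewrite subn0 leq_subr.
rewrite addnC -leq_subRL //; apply/bigmax_leqP => S' /andP[SS' /eqP cS'].
have S'0 : S' != set0 by rewrite -card_gt0 cS'.
rewrite (steiner_distE R S'0) leq_subRL // addnC.
apply: leq_trans (ancestors_le K S' order); apply: leq_add.
  exact/subset_leq_card/(hull_sub_ancestors R).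
apply: uncovered_sub.
have sub : code @: S' :\: code @: S \subset code @: (S' :\: S).
  apply/subsetP=> y; rewrite in_setD => /andP[yS /imsetP[x xS' yE]]; rewrite yE.
  by apply: imset_f; rewrite in_setD xS' andbT; apply: contra yS; rewrite yE; apply: imset_f.
apply: leq_trans (subset_leq_card sub) _.
by rewrite card_imset // cardsD (setIidPr SS') cS'.
Qed.

(** For l = k the only extension of S is S itself; double counting then assigns to each edge the
    k-sets it separates. *)
Lemma sum_eccentricity_diag k : 0 < k ->
  \sum_(S : {set V} | #|S| == k) eccentricity e k S =
  \sum_(x | x != c) separated_count N.+1 k #|below par x|.
Proof.
move=> k0.
transitivity (\sum_(S : {set V} | #|S| == k) \sum_(x | x != c) (x \in hull par S : nat)).
  apply: eq_bigr => S /eqP cS.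
  have S0 : S != set0 by rewrite -card_gt0 cS.
  transitivity #|hull par S|.
    rewrite -(steiner_distE R S0) /eccentricity (big_pred1 S) // => S' /=.
    apply/andP/eqP => [[SS' /eqP cS']|->]; last by rewrite subxx cS.
    by apply/esym/eqP; rewrite eqEcard SS' cS' cS leqnn.
  rewrite -sum1_card [RHS]big_mkcond [LHS]big_mkcond; apply: eq_bigr => x _.
  by case: (boolP (x \in hull par S)) => [/(hull_neq_root R) ->|]; rewrite ?if_same.
rewrite exchange_big; apply: eq_bigr => x xc /=.
rewrite -(card_coding K) -card_separated // -sum1_card -[LHS]big_mkcondr.
by apply: eq_bigl => S; rewrite !inE.
Qed.

Lemma sum_eccentricity_diag_ge k : 0 < k ->
  (forall x, x != c -> (#|below par x|).*2 <= #|V|) ->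
  (forall x y i s t, code x = Some (i, s) -> code y = Some (i, t) -> s <= t ->
     x \in below par y) ->
  \sum_i \sum_(0 <= s < len i) clipped_count N.+1 k s <=
  \sum_(S : {set V} | #|S| == k) eccentricity e k S.
Proof.
move=> k0 centroid order; rewrite sum_eccentricity_diag // -(sum_code_pos K).
apply: leq_sum => x xc; have [i [s xE]] := code_neq_root K xc; rewrite xE.
have := centroid x xc; rewrite (card_coding K) => half.
apply: separated_count_mono => //; rewrite geq_min.
by rewrite (card_below_ge K xE order).
Qed.

Lemma sum_eccentricity_diag_le k : 0 < k -> (forall i, (len i).*2 <= N.+1) ->
  (forall x y i t, code y = Some (i, t) -> x \in below par y ->
     exists2 s, code x = Some (i, s) & s <= t) ->
  \sum_(S : {set V} | #|S| == k) eccentricity e k S <=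
  \sum_i \sum_(0 <= s < len i) clipped_count N.+1 k s.
Proof.
move=> k0 half order; rewrite sum_eccentricity_diag // -(sum_code_pos K).
apply: leq_sum => x xc; have [i [s xE]] := code_neq_root K xc; rewrite xE.
have := code_cells K x; rewrite xE inE => sl; have := half i => hi.
rewrite /clipped_count; have -> : minn s.+1 N.+1./2 = s.+1.
  by apply/minn_idPl; rewrite geq_half_double; apply: leq_trans hi; rewrite leq_double.
apply: separated_count_mono; first exact: (card_below_le K xE order).
by apply: leq_trans hi; rewrite leq_double.
Qed.

End Bounds.

Lemma sum_eccentricity_BS_diag_le p N k (V : finType) (e : rel V) :
  1 < p -> 0 < k -> is_tree [set: V] e -> #|V| = N.+1 -> #|leaves e| = p ->
  \sum_(S : {set starlike_vertex (@BS_len N.+1 p)} | #|S| == k)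
     eccentricity (@BS N.+1 p) k S <=
  \sum_(S : {set V} | #|S| == k) eccentricity e k S.
Proof.
move=> p1 k0 T cV cL; have p0 := ltnW p1.
have [c [par [dep [R centroid]]]] := exists_centroid T.
have [len [code [K order]]] := exists_coding R cV cL p0.
apply: leq_trans (sum_eccentricity_diag_ge R K k0 centroid order).
have sumB : \sum_(i < p) BS_len N.+1 i = N.
  by have := card_BS (ltn0Sn N) p0; rewrite card_starlike => - [].
have half i : ((finfun (@BS_len N.+1 p)) i).*2 <= N.+1 by rewrite ffunE double_BS_len.
apply: leq_trans (sum_eccentricity_diag_le (@starlike_rooted p (@BS_len N.+1 p)) (starlike_coding sumB) k0 half
                    (starlike_order sumB)) _.
case: K => sumL _ _ _.
have gh : {homo clipped_count N.+1 k : x y / x <= y}.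
  move=> x y xy; apply: separated_count_mono; first by rewrite leq_min geq_minr andbT geq_min ltnS xy.
  rewrite -geq_half_double geq_minr //.
pose P (l : {ffun 'I_p -> nat}) :=
  \sum_i \sum_(0 <= s < l i) clipped_count N.+1 k s <=
  \sum_i \sum_(0 <= s < len i) clipped_count N.+1 k s.
suff PB : P [ffun i => BS_len N.+1 i] by exact: PB.
apply: (@balance_ind p N P p0 _ len sumL (leqnn _)) => l i j _ lt.
by apply: leq_trans; apply: sum_cells_exchange => //.
Qed.

(** Adding the total uncovered count [U] gives at least 'C(n, l) * (n - 1) for the tree and at most
    this for BS(n,p), while balancing does not decrease [U]. *)
Lemma sum_eccentricity_BS_le p N k l (V : finType) (e : rel V) :
  1 < p -> 1 < k -> l < k -> k <= N.+1 ->
  is_tree [set: V] e -> #|V| = N.+1 -> #|leaves e| = p ->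
  \sum_(S : {set starlike_vertex (@BS_len N.+1 p)} | #|S| == l)
     eccentricity (@BS N.+1 p) k S <=
  \sum_(S : {set V} | #|S| == l) eccentricity e k S.
Proof.
move=> p1 k1 lk kN T cV cL; have p0 := ltnW p1.
have [c [par [dep [R center]]]] := exists_center T.
have [len [code [K order]]] := exists_coding R cV cL p0.
have sumB : \sum_(i < p) BS_len N.+1 i = N.
  by have := card_BS (ltn0Sn N) p0; rewrite card_starlike => - [].
have KB := starlike_coding sumB; have RB := @starlike_rooted p (@BS_len N.+1 p).
have const (W : finType) : #|W| = N.+1 -> \sum_(S : {set W} | #|S| == l) N = 'C(N.+1, l) * N.
  by move=> cW; rewrite -cW -card_draws -sum_nat_const; apply: eq_bigl => S; rewrite inE.
pose U (len : {ffun 'I_p -> nat}) :=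
  \sum_(S : {set option ('I_p * 'I_N.+1)} | (S \subset cells N len) && (#|S| == l))
     uncovered len (k - l) S.
have lower : 'C(N.+1, l) * N <= \sum_(S : {set V} | #|S| == l) eccentricity e k S + U len.
  rewrite -(const V cV) /U -(sum_code K) -big_split; apply: leq_sum => S /eqP cS /=.
  rewrite -cS. apply: (eccentricity_ge R K center order k1 kN). by rewrite cS.
have upper : \sum_(S : {set starlike_vertex (@BS_len N.+1 p)} | #|S| == l)
     eccentricity (@BS N.+1 p) k S + U (finfun (@BS_len N.+1 p)) <= 'C(N.+1, l) * N.
  rewrite -(const _ (card_BS (ltn0Sn N) p0)) /U -(sum_code KB) -big_split.
  apply: leq_sum => S /eqP cS /=; rewrite -cS.
  by apply: (eccentricity_le RB KB (starlike_order sumB)); rewrite ?cS ltnW // ltnW.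
have UB : U len <= U (finfun (@BS_len N.+1 p)).
  case: K => sumL _ _ _.
  suff UB : U len <= U [ffun i => BS_len N.+1 i] by exact: UB.
  apply: (@balance_ind p N (fun l' => U len <= U l') p0 _ len sumL (leqnn _)).
  by move=> l' i j sl lt le; apply: leq_trans le _; apply: uncovered_exchange.
rewrite -(leq_add2r (U len)); apply: leq_trans lower.
by apply: leq_trans upper; rewrite leq_add2l.
Qed.

Theorem theorem5 (n k l p : nat) (T : finType) (e : rel T)
    (hk : (2 <= k)%N) (hlk : (l <= k)%N) (hkn : (k <= n)%N)
    (hT : is_tree [set: T] e) (hn : #|T| = n)
    (hleaves : #|leaves e| = p) (hp : (2 <= p)%N) :
  (avg_eccentricity (@BS n p) k l <= avg_eccentricity e k l)%R.
Proof.
case: n hkn hn => [|N] hkn hn; first by move: (leq_trans hk hkn).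
rewrite /avg_eccentricity (card_BS (ltn0Sn N) (ltnW hp)) hn.
apply: Num.Theory.ler_wpM2r; first by rewrite Num.Theory.invr_ge0 Num.Theory.ler0n.
(* For l = k no vertex is free to be moved across the centre, so this case goes through the
   centroid. *)
rewrite Num.Theory.ler_nat; move: hlk; rewrite leq_eqVlt => /orP[/eqP ->|lk].
  by apply: sum_eccentricity_BS_diag_le => //; apply: ltnW.
exact: sum_eccentricity_BS_le.
Qed.
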